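(* Let $f:\mathbb{C}^n\to\mathbb{C}^n$ be a polynomial map given by an arithmetic circuit, let $(x,r,A)$ be a $\frac78$-Moore box for $f$ and let $\tau\in(0,1)$. On input $f$, $x$, $r$, $A$ and $\tau$, the algorithm $\mathtt{refine}$ described in the context terminates and outputs a $\tau$-Moore box for $f$ with the same associated zero as the input box $(x,r,A)$.
   Context: **Norm, Moore boxes.** $\|\cdot\|$ is the norm on $\mathbb{C}^n$ given by $\|(z_1,\dots,z_n)\|=\max_i\max(|\mathrm{Re}\,z_i|,|\mathrm{Im}\,z_i|)$ and $B$ is its closed unit ball. For a polynomial map $f:\mathbb{C}^n\to\mathbb{C}^n$ and $\rho\in(0,1)$, a $\rho$-Moore box for $f$ is a triple $(x,r,A)\in\mathbb{C}^n\times\mathbb{R}_{>0}\times\mathbb{C}^{n\times n}$ such that $\|-r^{-1}Af(x)+(I_n-A\,\mathrm{d}f(x+ru))v\|\le\rho$ for all $u,v\in B$. There is then a unique zero of $f$ in $x+rB$, called the associated zero of the box. **Circuits.** An arithmetic circuit with input space $\mathbb{C}^n$ is a finite directed acyclic multigraph whose nodes are input nodes (labelled in $\{1,\dots,n\}$), constant nodes, and addition and multiplication nodes with exactly two incoming edges; each node computes a polynomial function in the obvious way, and a tuple of $m$ nodes represents a polynomial map to $\mathbb{C}^m$. A circuit for $\mathrm{d}f$ is obtained from one for $f$ by automatic differentiation. Constants of circuits are representable (see below). **Interval arithmetic with adaptive precision.** $\mathbb{F}\subset\mathbb{R}$ is the set of representable numbers (for instance the dyadic numbers $a2^b$, $a,b\in\mathbb{Z}$),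 closed under addition, subtraction and multiplication and containing $1/2$. $\square\mathbb{R}$ is the set of nonempty compact intervals with endpoints in $\mathbb{F}$; $\square\mathbb{C}$ is the set of pairs of elements of $\square\mathbb{R}$ (real and imaginary parts); $\square\mathbb{C}^n$ is the set of vectors of such boxes, viewed as subsets of $\mathbb{C}^n$. There are operations $\boxplus,\boxtimes$ on $\square\mathbb{R}$, depending on a parameter $u_{\mathrm{prec}}\in(0,1)$ (the unit roundoff, which the algorithm may change), with $x+y\in I\boxplus J$ and $xy\in I\boxtimes J$ for $x\in I$, $y\in J$, and such that for any $M\ge1$ and any $[a,b],[c,d]\in\square\mathbb{R}$ included in $[-M,M]$, $[a,b]\boxplus[c,d]\subseteq[a+c-Mu_{\mathrm{prec}},\,b+d+Mu_{\mathrm{prec}}]$ and $[a,b]\boxtimes[c,d]\subseteq[\min(ac,ad,bc,bd)-M^2u_{\mathrm{prec}},\,\max(ac,ad,bc,bd)+M^2u_{\mathrm{prec}}]$. These operations are extended to complex boxes, vectors and matrices by the usual formulas (negation of an interval is exact). $\square f$ and $\square\mathrm{d}f$ are the natural interval extensions, obtained by evaluating the circuits of $f$ and $\mathrm{d}f$ with $\boxplus,\boxtimes$ and replacing constants $c$ by $[c,c]$; so $f(x)\in\square f(X)$ if $x\in X$, and similarly for $\mathrm{d}f$. For a box $X$: $\mathrm{width}(X)=\sup_{x,y\in X}\|x-y\|$, $\|X\|_\square=\sup_{x\in X}\|x\|$, and $\mathrm{mid}(X)$ is a representable element of $X$ (close to its center). The inputs $x,r,A,\tau$ of the algorithms are representable.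 **Test $\mathtt{M}$.** $\mathtt{M}(\square f,\square\mathrm{d}f,x,r,A,\rho)$ computes in interval arithmetic the box $K=-r^{-1}A\cdot\square f(x)+(I_n-A\cdot\square\mathrm{d}f(x+rB))\cdot B$ (where $A\cdot\square f(x)$ is computed first and then scaled by $r^{-1}$, this scaling multiplying the box by $r^{-1}$) and returns True if and only if $\|K\|_\square\le\rho$. **Algorithm $\mathtt{refine}(f,x,r,A,\tau)$.** 1. $y\gets x$; $s\gets r$; $U\gets A$. 2. While $\mathtt{M}(\square f,\square\mathrm{d}f,y,s,U,\tau)$ is not True, do (main loop): (a) $\delta\gets A\cdot\square f(y)$ (interval arithmetic). (b) If $\|\delta\|_\square\le\frac1{64}\tau s$: set $s\gets\frac12s$, and then, if $s<\frac1{16}\tau r$, increase the precision enough so that $u_{\mathrm{prec}}=o(s)$. Else if $\mathrm{width}(y-\delta)>\frac1{40}\|\delta\|_\square$ ($y-\delta$ in interval arithmetic): increase the working precision. Else: $y\gets\mathrm{mid}(y-\delta)$ (a quasi-Newton iteration). (c) (in all cases) $U\gets\mathrm{mid}(\square\mathrm{d}f(y))^{-1}$, computed in unchecked arithmetic. 3. While $2s\le1$ and $\mathtt{M}(\square f,\square\mathrm{d}f,y,2s,U,\tau)$ is True: $s\gets2s$. 4. Return $(y,s,U)$. Conventions: the precision is never lowered during a run; increasing the working precision infinitely often makes $u_{\mathrm{prec}}\to0$; ''increase the precision enough so that $u_{\mathrm{prec}}=o(s)$'' means that $u_{\mathrm{prec}}$ is lowered, if necessary, so that $u_{\mathrm{prec}}\le\omega(s)$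 for a fixed function $\omega:(0,\infty)\to(0,1)$ with $\omega(s)/s\to0$ as $s\to0$. The matrix $U$ computed in 2(c) is representable and only has to satisfy $U-\mathrm{d}f(y)^{-1}\to0$ as $u_{\mathrm{prec}}\to0$, uniformly for $y$ in any compact set on which $\mathrm{d}f$ is invertible. *)

(* Defs.v *)
From HB Require Import structures.
From mathcomp Require Import all_boot all_order all_algebra.
From mathcomp Require Import complex.
(* multinomials is not imported: its notations clash with those of analysis *)
From mathcomp Require mpoly.
From mathcomp Require Import boolp classical_sets reals topology normedtype.
From mathcomp Require Import sequences.

Set Implicit Arguments.
Unset Strict Implicit.
Unset Printing Implicit Defensive.

Import Order.TTheory GRing.Theory Num.Theory numFieldNormedType.Exports.

Local Open Scope classical_set_scope.
Local Open Scope complex_scope.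
Local Open Scope ring_scope.

Local Notation Re := complex.Re.
Local Notation Im := complex.Im.

(* On column vectors this is the norm max_i max(|Re z_i|, |Im z_i|). *)
Definition mxnorm (R : realType) m n (A : 'M[R[i]]_(m, n)) : R :=
  \big[Num.max/0]_i \big[Num.max/0]_j Num.max `|Re (A i j)| `|Im (A i j)|.

Section MooreBoxes.
Variables (R : realType) (n : nat) (f : 'I_n -> mpoly.mpoly n R[i]).

Definition polymap (x : 'cV[R[i]]_n) : 'cV[R[i]]_n :=
  \col_i mpoly.meval (fun j => x j 0) (f i).

Definition jacobian (x : 'cV[R[i]]_n) : 'M[R[i]]_n :=
  \matrix_(i, j) mpoly.meval (fun k => x k 0) (mpoly.mderiv j (f i)).

Definition moore_box (rho : R) (x : 'cV[R[i]]_n) (r : R) (A : 'M[R[i]]_n) :=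
  0 < r /\
  forall u v : 'cV[R[i]]_n, mxnorm u <= 1 -> mxnorm v <= 1 ->
    mxnorm (- (r^-1)%:C *: (A *m polymap x)
            + (1%:M - A *m jacobian (x + r%:C *: u)) *m v) <= rho.

Definition associated_zero (x : 'cV[R[i]]_n) (r : R) (z : 'cV[R[i]]_n) :=
  unique (fun z' => polymap z' = 0 /\ mxnorm (z' - x) <= r) z.

End MooreBoxes.

(* A circuit is given by its nodes listed in a topological order: the incoming
   edges of a node start from nodes that precede it, which is acyclicity. *)
Inductive gate (K : Type) (n N : nat) :=
  | Input of 'I_n
  | Const of K
  | Add of 'I_N & 'I_N
  | Mul of 'I_N & 'I_N.
Arguments Input {K n N}.
Arguments Const {K n N}.
Arguments Add {K n N}.
Arguments Mul {K n N}.

Inductive circuit (K : Type) (n : nat) : nat -> Type :=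
  | Empty : circuit K n 0
  | Node N : circuit K n N -> gate K n N -> circuit K n N.+1.
Arguments Empty {K n}.

Section CircuitEvaluation.
Variables (K T : Type) (n : nat).
Variables (add mul : T -> T -> T) (cst : K -> T) (inp : 'I_n -> T).

Definition eval_gate N (val : 'I_N -> T) (g : gate K n N) : T :=
  match g with
  | Input k => inp k
  | Const c => cst c
  | Add a b => add (val a) (val b)
  | Mul a b => mul (val a) (val b)
  end.

Fixpoint eval N (c : circuit K n N) : 'I_N -> T :=
  match c in circuit _ _ N return 'I_N -> T with
  | Empty => fun k => False_rect T (notF (ltn_ord k))
  | Node _ c g => fun k =>
      if unlift ord_max k is Some k' then eval c k' else eval_gate (eval c) g
  end.

End CircuitEvaluation.

Fixpoint consts_in (K : Type) (P : K -> Prop) n N (c : circuit K n N) : Prop :=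
  match c with
  | Empty => True
  | Node _ c g => consts_in P c /\ (if g is Const a then P a else True)
  end.

(* A family of nodes, indexed by J, of a circuit over the complex numbers. *)
Record circuit_map (R : realType) (n : nat) (J : Type) := CircuitMap {
  cm_size : nat;
  cm_circuit : circuit R[i] n cm_size;
  cm_out : J -> 'I_cm_size }.

Definition cm_eval (R : realType) n J (c : circuit_map R n J)
    (x : 'cV[R[i]]_n) (k : J) : R[i] :=
  eval +%R *%R id (fun j => x j 0) (cm_circuit c) (cm_out c k).

Record representable (R : realType) := Representable {
  repr :> R -> Prop;
  reprD : forall a b, repr a -> repr b -> repr (a + b);
  reprB : forall a b, repr a -> repr b -> repr (a - b);
  reprM : forall a b, repr a -> repr b -> repr (a * b);
  repr_half : repr 2^-1 }.

Definition crepr (R : realType) (F : representable R) (z : R[i]) : Prop :=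
  F (Re z) /\ F (Im z).

Definition mx_repr (R : realType) (F : representable R) m n
    (A : 'M[R[i]]_(m, n)) : Prop := forall i j, crepr F (A i j).

(* Nonempty compact intervals with arbitrary real endpoints. *)
Record rint (R : realType) := Rint { lo : R; hi : R; lo_le_hi : lo <= hi }.

Section RealIntervals.
Variable R : realType.
Implicit Types I J : rint R.

Definition iset I : set R := [set x | lo I <= x <= hi I].

(* I belongs to the set of intervals with representable endpoints. *)
Definition irepr (F : representable R) I : Prop := F (lo I) /\ F (hi I).

Definition ipt (a : R) : rint R := Rint (lexx a).

Lemma hull_subproof (a b : R) : Num.min a b <= Num.max a b.
Proof. by rewrite ge_min !le_max lexx. Qed.

Definition ihull (a b : R) : rint R := Rint (hull_subproof a b).

Definition iopp I : rint R := ihull (- hi I) (- lo I).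

Definition iscale (t : R) I : rint R := ihull (t * lo I) (t * hi I).

End RealIntervals.

(* imul and the closure properties are about intervals with representable
   endpoints. The addition is described on all compact intervals, because the
   test M adds a box multiplied by r^-1, whose endpoints need not be
   representable. An addition given only on intervals with representable
   endpoints extends to such an operation, by the exact sum elsewhere. *)
Record interval_arith (R : realType) (F : representable R) := IntervalArith {
  iadd : R -> rint R -> rint R -> rint R;
  imul : R -> rint R -> rint R -> rint R;
  iadd_repr : forall u I J, 0 < u < 1 -> irepr F I -> irepr F J ->
    irepr F (iadd u I J);
  imul_repr : forall u I J, 0 < u < 1 -> irepr F I -> irepr F J ->
    irepr F (imul u I J);
  iadd_in : forall u I J x y, 0 < u < 1 -> iset I x -> iset J y ->
    iset (iadd u I J) (x + y);
  imul_in : forall u I J x y, 0 < u < 1 -> irepr F I -> irepr F J ->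
    iset I x -> iset J y -> iset (imul u I J) (x * y);
  iadd_err : forall u M I J, 0 < u < 1 -> 1 <= M ->
    iset I `<=` `[- M, M] -> iset J `<=` `[- M, M] ->
    iset (iadd u I J) `<=`
      `[lo I + lo J - M * u, hi I + hi J + M * u];
  imul_err : forall u M I J, 0 < u < 1 -> 1 <= M ->
    irepr F I -> irepr F J ->
    iset I `<=` `[- M, M] -> iset J `<=` `[- M, M] ->
    iset (imul u I J) `<=`
      `[Num.min (Num.min (lo I * lo J) (lo I * hi J))
                (Num.min (hi I * lo J) (hi I * hi J)) - M ^+ 2 * u,
        Num.max (Num.max (lo I * lo J) (lo I * hi J))
                (Num.max (hi I * lo J) (hi I * hi J)) + M ^+ 2 * u] }.

Definition cbox (R : realType) : Type := (rint R * rint R)%type.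

Section Boxes.
Variable R : realType.

Definition copp (Z : cbox R) : cbox R := (iopp Z.1, iopp Z.2).

Definition cscale (t : R) (Z : cbox R) : cbox R := (iscale t Z.1, iscale t Z.2).

Definition cpt (z : R[i]) : cbox R := (ipt (Re z), ipt (Im z)).

Definition cball (z : R[i]) (r : R) : cbox R :=
  (ihull (Re z - r) (Re z + r), ihull (Im z - r) (Im z + r)).

Section Matrices.
Variables m n : nat.

Definition bset (X : 'M[cbox R]_(m, n)) : set 'M[R[i]]_(m, n) :=
  [set A | forall i j, iset (X i j).1 (Re (A i j))
                    /\ iset (X i j).2 (Im (A i j))].

Definition box_repr (F : representable R) (X : 'M[cbox R]_(m, n)) : Prop :=
  forall i j, irepr F (X i j).1 /\ irepr F (X i j).2.

Definition bnorm (X : 'M[cbox R]_(m, n)) : R :=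
  sup [set mxnorm A | A in bset X].

Definition width (X : 'M[cbox R]_(m, n)) : R :=
  sup [set mxnorm (p.1 - p.2) | p in bset X `*` bset X].

Definition bopp (X : 'M[cbox R]_(m, n)) : 'M[cbox R]_(m, n) := map_mx copp X.

Definition bscale t (X : 'M[cbox R]_(m, n)) : 'M[cbox R]_(m, n) :=
  map_mx (cscale t) X.

Definition bpt (A : 'M[R[i]]_(m, n)) : 'M[cbox R]_(m, n) := map_mx cpt A.

End Matrices.

(* The set x + rB, with endpoints computed exactly; they are representable when
   x and r are. *)
Definition bball n (x : 'cV[R[i]]_n) (r : R) : 'cV[cbox R]_n :=
  \col_i cball (x i 0) r.

Section Arithmetic.
Variables (F : representable R) (ia : interval_arith F) (u : R).

Definition cadd (Z W : cbox R) : cbox R :=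
  (iadd ia u Z.1 W.1, iadd ia u Z.2 W.2).

Definition cmul (Z W : cbox R) : cbox R :=
  (iadd ia u (imul ia u Z.1 W.1) (iopp (imul ia u Z.2 W.2)),
   iadd ia u (imul ia u Z.1 W.2) (imul ia u Z.2 W.1)).

Definition csum (s : seq (cbox R)) : cbox R :=
  if s is Z :: s' then foldl cadd Z s' else cpt 0.

Definition badd m n (X Y : 'M[cbox R]_(m, n)) : 'M[cbox R]_(m, n) :=
  map2_mx cadd X Y.

Definition bsub m n (X Y : 'M[cbox R]_(m, n)) : 'M[cbox R]_(m, n) :=
  badd X (bopp Y).

Definition bmul m n p (X : 'M[cbox R]_(m, n)) (Y : 'M[cbox R]_(n, p)) :
    'M[cbox R]_(m, p) :=
  \matrix_(i, j) csum [seq cmul (X i k) (Y k j) | k <- enum 'I_n].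

Definition box_eval n J (c : circuit_map R n J) (X : 'cV[cbox R]_n) (k : J) :
    cbox R :=
  eval cadd cmul cpt (fun j => X j 0) (cm_circuit c) (cm_out c k).

Definition box_map n (cf : circuit_map R n 'I_n) (X : 'cV[cbox R]_n) :
    'cV[cbox R]_n := \col_i box_eval cf X i.

Definition box_jacobian n (cdf : circuit_map R n ('I_n * 'I_n))
    (X : 'cV[cbox R]_n) : 'M[cbox R]_n := \matrix_(i, j) box_eval cdf X (i, j).

Definition testM n (cf : circuit_map R n 'I_n)
    (cdf : circuit_map R n ('I_n * 'I_n))
    (x : 'cV[R[i]]_n) (r : R) (A : 'M[R[i]]_n) (rho : R) : bool :=
  let K := badd
    (bscale (- r^-1) (bmul (bpt A) (box_map cf (bpt x))))
    (bmul (bsub (bpt 1%:M) (bmul (bpt A) (box_jacobian cdf (bball x r))))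
          (bball 0 1)) in
  bnorm K <= rho.

End Arithmetic.
End Boxes.

Record midpoint (R : realType) (F : representable R) (n : nat) := Midpoint {
  mid :> 'cV[cbox R]_n -> 'cV[R[i]]_n;
  mid_repr : forall X, box_repr F X -> mx_repr F (mid X);
  mid_in : forall X, box_repr F X -> bset X (mid X) }.

(* incr_prec u: unit roundoff after one increase of the working precision u;
   lower_prec u s: unit roundoff after u has been lowered, if necessary, so as
   to be at most omega s. *)
Record precision_control (R : realType) := PrecisionControl {
  incr_prec : R -> R;
  incr_prec_le : forall u, 0 < u < 1 -> 0 < incr_prec u <= u;
  incr_prec_cvg : forall u : nat -> R, (forall k, 0 < u k < 1) ->
    nonincreasing_seq u ->
    (forall k, exists2 l, (k <= l)%N & u l.+1 = incr_prec (u l)) ->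
    u k @[k --> \oo] --> 0;
  omega : R -> R;
  omega_itv : forall s, 0 < s -> 0 < omega s < 1;
  omega_littleo : omega s / s @[s --> 0^'+] --> 0;
  lower_prec : R -> R -> R;
  lower_prec_le : forall u s, 0 < u < 1 -> 0 < s -> 0 < lower_prec u s <= u;
  lower_prec_omega : forall u s, 0 < u < 1 -> 0 < s ->
    lower_prec u s <= omega s;
  lower_prec_id : forall u s, 0 < u < 1 -> 0 < s -> u <= omega s ->
    lower_prec u s = u }.

(* uinv u y: the approximation of df(y)^-1 obtained in unchecked arithmetic with
   unit roundoff u. The coercion to numFieldType selects the topology of C^n. *)
Record unchecked_inverse (R : realType) (F : representable R) (n : nat)
    (f : 'I_n -> mpoly.mpoly n R[i]) := UncheckedInverse {
  uinv :> R -> 'cV[R[i]]_n -> 'M[R[i]]_n;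
  uinv_repr : forall u y, 0 < u < 1 -> mx_repr F y -> mx_repr F (uinv u y);
  uinv_cvg : forall K : set 'cV[(R[i] : numFieldType)]_n, compact K ->
    (forall y, K y -> jacobian f y \in unitmx) ->
    forall e : R, 0 < e -> \forall u \near 0^'+,
      forall y, K y -> mx_repr F y ->
        mxnorm (uinv u y - invmx (jacobian f y)) <= e }.

(* while cond body s t: the loop "while cond do body", started in the state s,
   terminates in the state t. *)
Inductive while (S : Type) (cond : S -> bool) (body : S -> S) : S -> S -> Prop :=
  | while_stop s : ~~ cond s -> while cond body s s
  | while_loop s t : cond s -> while cond body (body s) t -> while cond body s t.

Record state (R : realType) (n : nat) := State {
  st_y : 'cV[R[i]]_n;
  st_s : R;
  st_U : 'M[R[i]]_n;
  st_prec : R }.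

Section Refine.
Variables (R : realType) (F : representable R) (ia : interval_arith F).
Variables (prec : precision_control R) (n : nat) (md : midpoint F n).
Variables (f : 'I_n -> mpoly.mpoly n R[i]) (ui : unchecked_inverse F f).
Variables (cf : circuit_map R n 'I_n) (cdf : circuit_map R n ('I_n * 'I_n)).
Variables (r : R) (A : 'M[R[i]]_n) (tau : R).

Definition refine_body (st : state R n) : state R n :=
  let: State y s U u := st in
  let delta := bmul ia u (bpt A) (box_map ia u cf (bpt y)) in
  let y_delta := bsub ia u (bpt y) delta in
  let: (y', s', u') :=
    if bnorm delta <= 64^-1 * tau * s then
      let s' := 2^-1 * s in
      (y, s', if s' < 16^-1 * tau * r then lower_prec prec u s' else u)
    else if 40^-1 * bnorm delta < width y_delta then (y, s, incr_prec prec u)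
    else (md y_delta, s, u) in
  State y' s' (ui u' y') u'.

Definition main_cond (st : state R n) : bool :=
  ~~ testM ia (st_prec st) cf cdf (st_y st) (st_s st) (st_U st) tau.

Definition double_radius (st : state R n) : state R n :=
  State (st_y st) (2 * st_s st) (st_U st) (st_prec st).

Definition double_cond (st : state R n) : bool :=
  (2 * st_s st <= 1) &&
  testM ia (st_prec st) cf cdf (st_y st) (2 * st_s st) (st_U st) tau.

(* The run of refine on f, x, r, A, tau, started with unit roundoff u0,
   terminates and outputs (y, s, U). As the run is determined by these data,
   there is at most one such output. *)
Definition refine_outputs (x : 'cV[R[i]]_n) (u0 : R)
    (y : 'cV[R[i]]_n) (s : R) (U : 'M[R[i]]_n) : Prop :=
  exists (st : state R n) (u : R),
    while main_cond refine_body (State x r A u0) st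
    /\ while double_cond double_radius st (State y s U u).

End Refine.

(* Main.v *)
(* Let N(y) = y - A f(y). On a 7/8-Moore box, N is a 7/8-contraction of the
   closed ball x + rB into x + (7/8)rB, hence has a unique fixed point z there,
   which is the unique zero of f as A is invertible. The loop preserves
   |y - x| <= r and |y - z| <= s: a quasi-Newton step moves y to N(y) up to an
   error |A f(y)|/39 and contracts |y - z| by 12/13, and the radius is halved
   only when |y - z| <= 8 |A f(y)| <= s/8. Assume that the test never succeeds.
   If s were halved infinitely often it would tend to 0, with a unit roundoff
   o(s), and then the box computed by the test right after a halving has norm at
   most tau/4 + o(1). So s is eventually constant and |delta| > tau s/64 from
   then on; as |A f(y)| = O(|y - z|) only finitely many steps are quasi-Newton
   steps, and y is eventually constant too, while the unit roundoff, hence the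
   width of y - delta, tends to 0: no further increase of the precision is
   requested. The zero of the output box is z since |y - z| <= s. *)

Require Import Defs.
From mathcomp Require Import all_boot all_order all_algebra.
From mathcomp Require Import complex polyrcf ring lra.
From mathcomp Require mpoly.
From mathcomp Require Import boolp classical_sets reals topology normedtype.
From mathcomp Require Import sequences.

Set Implicit Arguments.
Unset Strict Implicit.
Unset Printing Implicit Defensive.

Import -(notations) mpoly.
Import Order.TTheory GRing.Theory Num.Theory numFieldNormedType.Exports.

Local Open Scope classical_set_scope.
Local Open Scope complex_scope.
Local Open Scope ring_scope.

Local Notation Re := complex.Re.
Local Notation Im := complex.Im.

(** The quasi-Newton map keeps the initial [A] during the whole run, so one contraction estimate on
    x + rB serves every step; U acts only through the test, and its quality matters only just after
    a halving. That estimate may lose no factor depending on n: the mean value theorem is applied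
    separately to the real and imaginary part of each coordinate, which is what the max norm sees.
    Crude product bounds with a factor n are kept for terms that tend to 0. The constant 8 is 1/(1 -
    7/8). With the threshold 1/64, a halving leaves |A f(y)| <= tau s'/32 for the new radius s',
    hence |df(y)^-1 f(y)| <= tau s'/4, and the rest of tau is available for the errors of the test.
    The obstacle is uniformity: y moves, so the bounds on box evaluations may depend only on the
    circuits and on x + rB. They are stated relatively to a scale e. It is u for evaluations at a
    point, because U f(y) is divided by s while u = o(s); it is a small eta >= s for the Jacobian
    over y + sB, which only has to be close to df(y). *)

Section ComplexParts.
Variable R : realType.
Implicit Types z w : R[i].

Lemma cReD z w : Re (z + w) = Re z + Re w. Proof. by case: z; case: w. Qed.
Lemma cImD z w : Im (z + w) = Im z + Im w. Proof. by case: z; case: w. Qed.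
Lemma cReN z : Re (- z) = - Re z. Proof. by case: z. Qed.
Lemma cImN z : Im (- z) = - Im z. Proof. by case: z. Qed.
Lemma cReM z w : Re (z * w) = Re z * Re w - Im z * Im w.
Proof. by case: z; case: w. Qed.
Lemma cImM z w : Im (z * w) = Re z * Im w + Im z * Re w.
Proof. by case: z; case: w. Qed.
Lemma cReZ (t : R) z : Re (t%:C * z) = t * Re z.
Proof. by case: z => a b /=; rewrite mul0r subr0. Qed.
Lemma cImZ (t : R) z : Im (t%:C * z) = t * Im z.
Proof. by case: z => a b /=; rewrite mul0r addr0. Qed.

Lemma cRe_sum I (s : seq I) (F : I -> R[i]) :
  Re (\sum_(i <- s) F i) = \sum_(i <- s) Re (F i).
Proof. exact: (big_morph _ cReD). Qed.

Lemma cIm_sum I (s : seq I) (F : I -> R[i]) :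
  Im (\sum_(i <- s) F i) = \sum_(i <- s) Im (F i).
Proof. exact: (big_morph _ cImD). Qed.

End ComplexParts.

Definition cE := (cReD, cImD, cReN, cImN, cReM, cImM).

(** * The max norm on complex matrices *)

Section MatrixNorm.
Variable R : realType.

(** The condition [0 <= c] accounts for matrices without entries, whose norm is the default value 0
    of the big maximum. *)
Lemma mxnormP m n (A : 'M[R[i]]_(m, n)) (c : R) :
  mxnorm A <= c <->
  0 <= c /\ forall i j, `|Re (A i j)| <= c /\ `|Im (A i j)| <= c.
Proof.
split=> [/bigmax_leP[c0 Ac]|[c0 Ac]].
  split=> // i j; have /bigmax_leP[_ Aic] := Ac i isT.
  by have := Aic j isT; rewrite ge_max => /andP[].
apply/bigmax_leP; split=> // i _; apply/bigmax_leP; split=> // j _.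
by have [rA iA] := Ac i j; rewrite ge_max rA iA.
Qed.

Lemma mxnorm_ge0 m n (A : 'M[R[i]]_(m, n)) : 0 <= mxnorm A.
Proof. by have /mxnormP[] := lexx (mxnorm A). Qed.

Lemma le_mxnorm_Re m n (A : 'M[R[i]]_(m, n)) i j : `|Re (A i j)| <= mxnorm A.
Proof. by have /mxnormP[_ /(_ i j)[]] := lexx (mxnorm A). Qed.

Lemma le_mxnorm_Im m n (A : 'M[R[i]]_(m, n)) i j : `|Im (A i j)| <= mxnorm A.
Proof. by have /mxnormP[_ /(_ i j)[]] := lexx (mxnorm A). Qed.

Lemma mxnorm0 m n : mxnorm (0 : 'M[R[i]]_(m, n)) = 0.
Proof.
apply/eqP; rewrite eq_le mxnorm_ge0 andbT; apply/mxnormP; split=> // i j.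
by rewrite mxE /= normr0.
Qed.

Lemma mxnorm_eq0 m n (A : 'M[R[i]]_(m, n)) : mxnorm A <= 0 -> A = 0.
Proof.
move=> /mxnormP[_ A0]; apply/matrixP=> i j; rewrite mxE.
have [] := A0 i j; rewrite !normr_le0 => /eqP a0 /eqP b0.
by apply/eqP; rewrite eq_complex a0 b0 !eqxx.
Qed.

Lemma mxnormD m n (A B : 'M[R[i]]_(m, n)) :
  mxnorm (A + B) <= mxnorm A + mxnorm B.
Proof.
apply/mxnormP; split=> [|i j]; first by rewrite addr_ge0 ?mxnorm_ge0.
rewrite mxE cReD cImD; split; apply: le_trans (ler_normD _ _) _;
  by rewrite lerD ?le_mxnorm_Re ?le_mxnorm_Im.
Qed.

Lemma mxnormN m n (A : 'M[R[i]]_(m, n)) : mxnorm (- A) = mxnorm A.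
Proof.
suff H (B : 'M[R[i]]_(m, n)) : mxnorm (- B) <= mxnorm B.
  by apply/eqP; rewrite eq_le H -{1}(opprK A) H.
apply/mxnormP; split=> [|i j]; first exact: mxnorm_ge0.
by rewrite mxE cReN cImN !normrN le_mxnorm_Re le_mxnorm_Im.
Qed.

Lemma mxnormB m n (A B : 'M[R[i]]_(m, n)) :
  mxnorm (A - B) <= mxnorm A + mxnorm B.
Proof. by rewrite -(mxnormN B) mxnormD. Qed.

Lemma mxnorm_distC m n (A B : 'M[R[i]]_(m, n)) :
  mxnorm (A - B) = mxnorm (B - A).
Proof. by rewrite -opprB mxnormN. Qed.

Lemma mxnorm_distD m n (B A C : 'M[R[i]]_(m, n)) :
  mxnorm (A - C) <= mxnorm (A - B) + mxnorm (B - C).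
Proof. by rewrite -{1}(subrK B A) -addrA mxnormD. Qed.

(** Scalars are real because this norm is not compatible with complex ones: 1 + i has norm 1 but its
    square 2i has norm 2. *)
Lemma mxnormZ m n (t : R) (A : 'M[R[i]]_(m, n)) :
  mxnorm (t%:C *: A) <= `|t| * mxnorm A.
Proof.
apply/mxnormP; split=> [|i j]; first by rewrite mulr_ge0 ?mxnorm_ge0.
by rewrite mxE cReZ cImZ !normrM !ler_wpM2l ?le_mxnorm_Re ?le_mxnorm_Im.
Qed.

Lemma scale_realA m n (s t : R) (A : 'M[R[i]]_(m, n)) :
  s%:C *: (t%:C *: A) = (s * t)%:C *: A.
Proof. by rewrite scalerA (rmorphM (real_complex R)). Qed.

(** Each entry is a sum of n complex products, and the real or imaginary part of a complex product
    has two terms. *)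
Lemma mxnormM m n p (A : 'M[R[i]]_(m, n)) (B : 'M[R[i]]_(n, p)) :
  mxnorm (A *m B) <= 2 * n%:R * mxnorm A * mxnorm B.
Proof.
have prod_le (a b c d : R) :
    `|a| <= mxnorm A -> `|b| <= mxnorm B -> `|c| <= mxnorm A ->
    `|d| <= mxnorm B -> `|a * b| + `|c * d| <= 2 * mxnorm A * mxnorm B.
  move=> aA bB cA dB; rewrite !normrM.
  have -> : 2 * mxnorm A * mxnorm B = mxnorm A * mxnorm B + mxnorm A * mxnorm B.
    by ring.
  by rewrite lerD // ler_pM.
have sum_le (F : 'I_n -> R) : (forall k, `|F k| <= 2 * mxnorm A * mxnorm B) ->
    `|\sum_k F k| <= 2 * n%:R * mxnorm A * mxnorm B.
  move=> Fb; apply: le_trans (ler_norm_sum _ _ _) _.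
  apply: le_trans (ler_sum _ (fun k _ => Fb k)) _.
  rewrite sumr_const card_ord -mulr_natl le_eqVlt; apply/orP; left; apply/eqP.
  by ring.
apply/mxnormP; split=> [|i j].
  by rewrite !mulr_ge0 ?mxnorm_ge0.
rewrite mxE cRe_sum cIm_sum; split; apply: sum_le => k; rewrite cE.
- by apply: le_trans (ler_normB _ _) _; apply: prod_le;
    rewrite ?le_mxnorm_Re ?le_mxnorm_Im.
- by apply: le_trans (ler_normD _ _) _; apply: prod_le;
    rewrite ?le_mxnorm_Re ?le_mxnorm_Im.
Qed.

End MatrixNorm.

(** * Mean value inequality *)

Section MeanValue.
Variables (R : realType) (n : nat).

Lemma meval_mderiv_var (K : comNzRingType) (v : 'I_n -> K) i j :
  meval v (mderiv j (mpolyX K (mnm1 i))) = (i == j)%:R.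
Proof.
rewrite mderivX mnm1E; have [->|_] := eqVneq i j; last by rewrite scale0r meval0.
have -> : mnm_sub (mnm1 j) (mnm1 j) = mnm0.
  by apply/mnmP => k; rewrite !mnmE subnn.
by rewrite mpolyX0 scale1r meval1.
Qed.

(** The polynomials whose restriction to the line has this form contain the constants and the
    variables and are stable under sums and products. This reduces calculus on C^n to univariate
    polynomials. *)
Lemma mpoly_line (K : comNzRingType) (a v : 'I_n -> K) (h : mpoly n K) :
  exists P : {poly K}, forall t,
    P.[t] = meval (fun j => a j + t * v j) h /\
    P^`().[t] = \sum_j v j * meval (fun j => a j + t * v j) (mderiv j h).
Proof.
pose ok h := exists P : {poly K}, forall t,
  P.[t] = meval (fun j => a j + t * v j) h /\
  P^`().[t] = \sum_j v j * meval (fun j => a j + t * v j) (mderiv j h).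
have okC c : ok (mpolyC n c).
  exists c%:P => t; rewrite hornerC mevalC derivC horner0; split=> //.
  by rewrite big1 // => j _; rewrite mderivC meval0 mulr0.
have okM p q : ok p -> ok q -> ok (p * q).
  move=> [P HP] [Q HQ]; exists (P * Q) => t; have [p1 p2] := HP t.
  have [q1 q2] := HQ t; rewrite derivM !hornerE p1 p2 q1 q2 mevalM; split=> //.
  rewrite mulr_suml mulr_sumr -big_split /=; apply: eq_bigr => j _.
  by rewrite mderivM mevalD !mevalM; ring.
have okD p q : ok p -> ok q -> ok (p + q).
  move=> [P HP] [Q HQ]; exists (P + Q) => t; have [p1 p2] := HP t.
  have [q1 q2] := HQ t; rewrite derivD !hornerE p1 p2 q1 q2 mevalD; split=> //.
  by rewrite -big_split /=; apply: eq_bigr => j _; rewrite linearD mevalD mulrDr.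
have okX i : ok (mpolyX K (mnm1 i)).
  exists ((a i)%:P + 'X * (v i)%:P) => t; split; first by rewrite !hornerE mevalXU.
  rewrite derivD derivM derivX !derivC !hornerE (bigD1 i) //= big1 => [|j ji].
    by rewrite meval_mderiv_var eqxx mulr1; ring.
  by rewrite meval_mderiv_var eq_sym (negPf ji) mulr0.
elim/mpolyind: h => [|c m p _ _ okp]; first by rewrite -mpolyC0; exact: okC.
rewrite -mul_mpolyC; apply: (okD) => //; apply: (okM); first exact: okC.
rewrite mpolyXE_id; apply: big_ind => //; first exact: okC.
by move=> i _; elim: (m _) => [|k IH]; [exact: okC | rewrite exprS; exact: okM].
Qed.

(** [Q] takes the real parts of the coefficients: at a real point this commutes with evaluation, and
    the real mean value theorem becomes available. *)
Lemma poly_Re (P : {poly R[i]}) : exists Q : {poly R}, forall t,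
  Q.[t] = Re P.[t%:C] /\ Q^`().[t] = Re P^`().[t%:C].
Proof.
elim/poly_ind: P => [|P c [Q HQ]].
  by exists 0 => t; rewrite !deriv0 !horner0.
exists (Q * 'X + (Re c)%:P) => t; have [Q0 Q1] := HQ t.
rewrite !(derivD, derivM, derivX, derivC) !hornerE Q0 Q1 !cE /=; split; ring.
Qed.

(** A mean value equality fails for complex values, hence the real parts; imaginary parts are
    recovered by applying it to a multiple of [h]. *)
Lemma mpoly_mean_value (h : mpoly n R[i]) (a b : 'I_n -> R[i]) :
  exists2 t : R, 0 <= t <= 1 &
    Re (meval b h) - Re (meval a h) =
    Re (\sum_j (b j - a j) *
          meval (fun j => a j + t%:C * (b j - a j)) (mderiv j h)).
Proof.
have [P HP] := mpoly_line a (fun j => b j - a j) h.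
have [Q HQ] := poly_Re P.
have [t t01 Qt] := poly_mvt Q (@ltr01 R).
exists t; first by move: t01; rewrite in_itv /= => /andP[t0 t1]; rewrite !ltW.
have [_ <-] := HP t%:C; have [_ <-] := HQ t.
rewrite subr0 mulr1 in Qt; rewrite -Qt.
have [-> _] := HQ 1; have [-> _] := HQ 0.
have [-> _] := HP 1%:C; have [-> _] := HP 0%:C.
by congr (Re _ - Re _); apply: meval_eq => j; rewrite ?mul0r ?addr0 // mul1r; ring.
Qed.

End MeanValue.

(** * Moore boxes *)

Section GeometricLimit.
Variable R : realType.

(** The segments of center [a k] and radius [c * q ^+ k] are nested, since the radius shrinks by
    exactly the allowed step; the limit is the supremum of their lower ends. *)
Lemma geometric_limit (a : nat -> R) (c q : R) : 0 <= c -> 0 <= q < 1 ->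
  (forall k, `|a k.+1 - a k| <= c * q ^+ k * (1 - q)) ->
  exists l, forall k, `|a k - l| <= c * q ^+ k.
Proof.
move=> c0 /andP[q0 q1] aS.
pose lower k := a k - c * q ^+ k; pose upper k := a k + c * q ^+ k.
have cq0 k : 0 <= c * q ^+ k by rewrite mulr_ge0 ?exprn_ge0.
have stepS k : lower k <= lower k.+1 /\ upper k.+1 <= upper k.
  have := aS k; rewrite ler_norml => /andP[].
  by rewrite /lower /upper exprS !mulrBr mulr1 => *; split; lra.
have lower_mono k j : lower k <= lower (k + j)%N.
  by elim: j => [|j IH]; rewrite ?addn0 // addnS (le_trans IH) // (stepS _).1.
have upper_mono k j : upper (k + j)%N <= upper k.
  by elim: j => [|j IH]; rewrite ?addn0 // addnS (le_trans _ IH) // (stepS _).2.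
have lower_upper k j : lower k <= upper j.
  apply: le_trans (lower_mono k j) _; apply: le_trans _ (upper_mono j k).
  by rewrite addnC /lower /upper; have := cq0 (j + k)%N; lra.
have ubl j : ubound (range lower) (upper j) by move=> _ [k _ <-].
have supl : has_sup (range lower).
  by split; [exists (lower 0); exists 0 | exists (upper 0)].
exists (sup (range lower)) => k; rewrite ler_distlC.
have lo : lower k <= sup (range lower) by apply: ub_le_sup supl.2 _ _; exists k.
have hi : sup (range lower) <= upper k by apply: ge_sup supl.1 (ubl k).
by move: lo hi; rewrite /lower /upper => lo hi; lra.
Qed.

End GeometricLimit.

Section MooreBoxTheory.
Variables (R : realType) (n : nat) (f : 'I_n -> mpoly n R[i]).
Implicit Types (x z w v : 'cV[R[i]]_n) (A : 'M[R[i]]_n) (r rho : R).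

Definition quasi_newton A z : 'cV[R[i]]_n := z - A *m polymap f z.

(** The scalar mean value theorem is applied to each real coordinate, with a point [t] depending on
    the coordinate, so no constant is lost. The shift [e] allows two uses: [e = 0] gives the
    Lipschitz bound, and e = - A f(x) gives the stability of the ball. *)
Lemma quasi_newton_mean_value A (a b e : 'cV[R[i]]_n) (c : R) : 0 <= c ->
  (forall t : R, 0 <= t <= 1 ->
    mxnorm (e + (1%:M - A *m jacobian f (a + t%:C *: (b - a))) *m (b - a))
      <= c) ->
  mxnorm (e + (quasi_newton A b - quasi_newton A a)) <= c.
Proof.
move=> c0 mv.
have comp (k : R[i]) i : exists2 t : R, 0 <= t <= 1 &
    Re (k * (quasi_newton A b - quasi_newton A a) i 0) =
    Re (k * ((1%:M - A *m jacobian f (a + t%:C *: (b - a))) *m (b - a)) i 0).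
  (* The i-th coordinate of the quasi-Newton map times [k], as a polynomial; its gradient is [k]
     times row i of I - A df. *)
  pose h := mpolyC n k * (mpolyX _ (mnm1 i) - \sum_j mpolyC n (A i j) * f j).
  have hE z : meval (fun j => z j 0) h = k * quasi_newton A z i 0.
    rewrite mevalM mevalC mevalB mevalXU (raddf_sum (meval _)) !mxE.
    congr (_ * (_ - _)).
    by apply: eq_bigr => j _; rewrite /= mevalM mevalC !mxE.
  have dhE z j : meval (fun j => z j 0) (mderiv j h) =
      k * (1%:M - A *m jacobian f z) i j.
    rewrite mderivM mderivC mul0r add0r mevalM mevalC; congr (_ * _).
    rewrite mderivB mevalB meval_mderiv_var !mxE; congr (_ - _).
    rewrite (raddf_sum (mderiv j)) (raddf_sum (meval _)); apply: eq_bigr => l _ /=.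
    by rewrite mderivM mderivC mul0r add0r mevalM mevalC !mxE.
  have [t t01 tE] := mpoly_mean_value h (fun j => a j 0) (fun j => b j 0).
  exists t => //; move: tE; rewrite !hE -raddfB -mulrBr !mxE => ->.
  congr Re; rewrite mulr_sumr; apply: eq_bigr => j _.
  have -> : (fun j => a j 0 + t%:C * (b j 0 - a j 0)) =
      (fun j => (a + t%:C *: (b - a)) j 0).
    by apply/funext => l; rewrite !mxE.
  by rewrite dhE !mxE mulrCA; congr (_ * _); rewrite mulrC.
apply/mxnormP; split=> // i j; rewrite ord1; split.
  have [t t01] := comp 1 i; rewrite !mul1r => tE.
  rewrite mxE cReD tE; have /(le_trans (le_mxnorm_Re _ i 0)) := mv t t01.
  by rewrite mxE cReD.
(* The factor -i turns the imaginary part into a real part. *)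
have [t t01] := comp (Complex 0 (-1)) i; rewrite !cE /=.
rewrite !mul0r !sub0r !mulN1r !opprK => tE.
rewrite mxE cImD tE; have /(le_trans (le_mxnorm_Im _ i 0)) := mv t t01.
by rewrite mxE cImD.
Qed.

Section InABox.
Variables (rho r : R) (x : 'cV[R[i]]_n) (A : 'M[R[i]]_n).
Hypotheses (rho_lt1 : rho < 1) (box : moore_box f rho x r A).

Let r_gt0 : 0 < r. Proof. by case: box. Qed.

Let rho_ge0 : 0 <= rho.
Proof.
case: box => _ /(_ 0 0); rewrite mxnorm0 => /(_ ler01 ler01).
exact/le_trans/mxnorm_ge0.
Qed.

Let rho_r : rho * r <= r. Proof. by rewrite ger_pMl // ltW. Qed.

Let scale_in z : mxnorm (z - x) <= r ->
  exists2 u, mxnorm u <= 1 & z = x + r%:C *: u.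
Proof.
move=> zx; exists ((r^-1)%:C *: (z - x)).
  apply: le_trans (mxnormZ _ _) _.
  by rewrite gtr0_norm ?invr_gt0 // ler_pdivrMl // mulr1.
rewrite scale_realA divff ?gt_eqF // scale1r; apply/esym.
by rewrite addrC subrK.
Qed.

(** The half-difference of the box inequalities for w and -w removes the constant term r^-1 A f(x);
    scaling then reaches every [v]. *)
Lemma moore_box_contraction z v : mxnorm (z - x) <= r ->
  mxnorm ((1%:M - A *m jacobian f z) *m v) <= rho * mxnorm v.
Proof.
move=> /scale_in[u u1 ->]; set X := 1%:M - _.
have unit_le w : mxnorm w <= 1 -> mxnorm (X *m w) <= rho.
  move=> w1; have [_ bx] := box; have /(bx u w u1) := w1.
  have /(bx u _ u1) : mxnorm (- w) <= 1 by rewrite mxnormN.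
  rewrite -/X mulmxN => le1 le2.
  have := mxnormB (- (r^-1)%:C *: (A *m polymap f x) + X *m w)
                  (- (r^-1)%:C *: (A *m polymap f x) - X *m w).
  have -> : forall p q : 'cV[R[i]]_n, p + q - (p - q) = 2%:C *: q.
    move=> p q; rewrite opprB addrC addrA subrK.
    by rewrite (rmorphD (real_complex R) 1 1) scalerDl scale1r.
  move=> le3; have := mxnormZ (2^-1) (2%:C *: (X *m w)).
  rewrite scale_realA mulVf ?pnatr_eq0 // scale1r => le4.
  apply: le_trans le4 _; rewrite gtr0_norm ?invr_gt0 // ler_pdivrMl //.
  by rewrite (le_trans le3) // mulr_natl mulr2n lerD.
have [v0|v0] := leP (mxnorm v) 0.
  by rewrite (mxnorm_eq0 v0) mulmx0 mxnorm0 mulr0.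
have := unit_le ((mxnorm v)^-1%:C *: v) _.
have -> : mxnorm ((mxnorm v)^-1%:C *: v) <= 1.
  apply: le_trans (mxnormZ _ _) _.
  by rewrite gtr0_norm ?invr_gt0 // mulVf ?gt_eqF.
move=> /(_ isT); rewrite -scalemxAr => le1.
have := mxnormZ (mxnorm v) ((mxnorm v)^-1%:C *: (X *m v)).
rewrite scale_realA divff ?gt_eqF // scale1r => le2.
by apply: le_trans le2 _; rewrite gtr0_norm // mulrC ler_wpM2r // ltW.
Qed.

Lemma moore_box_convex z w (t : R) : mxnorm (z - x) <= r ->
  mxnorm (w - x) <= r -> 0 <= t <= 1 ->
  mxnorm (z + t%:C *: (w - z) - x) <= r.
Proof.
move=> zx wx /andP[t0 t1].
have -> : z + t%:C *: (w - z) - x =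
    (1 - t)%:C *: (z - x) + t%:C *: (w - x).
  rewrite rmorphB scalerBl scale1r !scalerBr.
  by apply/colP=> i; rewrite !mxE; ring.
apply: le_trans (mxnormD _ _) _; have /lerD := mxnormZ (1 - t) (z - x).
move=> /(_ _ _ (mxnormZ t (w - x))) /le_trans -> //.
rewrite !ger0_norm ?subr_ge0 //.
have := ler_wpM2l t0 wx; have t1' : 0 <= 1 - t by rewrite subr_ge0.
by have := ler_wpM2l t1' zx; nra.
Qed.

Lemma quasi_newton_lipschitz z w : mxnorm (z - x) <= r ->
  mxnorm (w - x) <= r ->
  mxnorm (quasi_newton A z - quasi_newton A w) <= rho * mxnorm (z - w).
Proof.
move=> zx wx; rewrite -[X in mxnorm X]add0r.
apply: quasi_newton_mean_value => [|t t01].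
  by rewrite mulr_ge0 ?mxnorm_ge0.
by rewrite add0r; apply: moore_box_contraction; apply: moore_box_convex.
Qed.

(** Here the whole box inequality is used, constant term included: along the segment from x to z it
    is taken at v = (z - x)/r and multiplied by r. *)
Lemma quasi_newton_maps z : mxnorm (z - x) <= r ->
  mxnorm (quasi_newton A z - x) <= rho * r.
Proof.
move=> zx; have -> : quasi_newton A z - x =
    - (A *m polymap f x) + (quasi_newton A z - quasi_newton A x).
  by rewrite /quasi_newton; apply/colP=> i; rewrite !mxE; ring.
apply: quasi_newton_mean_value => [|t /andP[t0 t1]].
  by rewrite mulr_ge0 // ltW.
have [u u1 zE] := scale_in zx.
have zxE : z - x = r%:C *: u by rewrite zE addrC addKr.
have tu1 : mxnorm (t%:C *: u) <= 1.
  apply: le_trans (mxnormZ _ _) _; rewrite ger0_norm //.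
  by rewrite -[1]mulr1 ler_pM ?mxnorm_ge0.
have [_ /(_ _ _ tu1 u1) bx] := box.
rewrite zxE scale_realA mulrC -scale_realA -scalemxAr.
have := mxnormZ r (- (r^-1)%:C *: (A *m polymap f x) +
  (1%:M - A *m jacobian f (x + r%:C *: (t%:C *: u))) *m u).
rewrite scalerDr !scaleNr !scalerN (scale_realA r r^-1) divff ?gt_eqF //.
rewrite scale1r gtr0_norm // => /le_trans -> //.
by rewrite -scaleNr mulrC ler_pM2r.
Qed.

(** Write v = (I - A df(z)) v + A df(z) v. For [rho = 7 / 8] this gives the factor 8 used everywhere
    later. *)
Lemma moore_box_residual z v : mxnorm (z - x) <= r ->
  (1 - rho) * mxnorm v <= mxnorm (A *m jacobian f z *m v).
Proof.
move=> /(moore_box_contraction v); rewrite mulmxBl mul1mx => le1.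
have := mxnormD (v - A *m jacobian f z *m v) (A *m jacobian f z *m v).
by rewrite subrK; lra.
Qed.

Let unit_of_injective (B : 'M[R[i]]_n) :
  (forall v, B *m v = 0 -> v = 0) -> B \in unitmx.
Proof.
move=> inj; rewrite unitmxE unitfE -det_tr; apply/negP => /det0P[v v0 vB].
case/eqP: v0; apply/trmx_inj; rewrite trmx0; apply: inj.
by apply/trmx_inj; rewrite trmx_mul trmxK vB trmx0.
Qed.

Lemma moore_box_unitmx z : mxnorm (z - x) <= r ->
  A \in unitmx /\ jacobian f z \in unitmx.
Proof.
move=> zx; apply/andP; rewrite -unitmx_mul.
apply: unit_of_injective => v Bv0; apply: mxnorm_eq0.
have := moore_box_residual v zx; rewrite Bv0 mxnorm0.
by rewrite pmulr_rle0 // subr_gt0.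
Qed.

Lemma quasi_newton_fixedP z : mxnorm (z - x) <= r ->
  quasi_newton A z = z <-> polymap f z = 0.
Proof.
move=> zx; have [uA _] := moore_box_unitmx zx.
split=> [|fz0]; last by rewrite /quasi_newton fz0 mulmx0 subr0.
rewrite /quasi_newton => fix_z.
have Af0 : A *m polymap f z = 0.
  by rewrite -(subKr z (A *m polymap f z)) fix_z subrr.
by rewrite -(mulKmx uA (polymap f z)) Af0 mulmx0.
Qed.

Lemma moore_box_zero_unique z w : mxnorm (z - x) <= r ->
  mxnorm (w - x) <= r -> polymap f z = 0 -> polymap f w = 0 -> z = w.
Proof.
move=> zx wx /(quasi_newton_fixedP zx) zfix /(quasi_newton_fixedP wx) wfix.
apply/subr0_eq/mxnorm_eq0; have := quasi_newton_lipschitz zx wx.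
by rewrite zfix wfix; have := mxnorm_ge0 (z - w); have := rho_lt1; nra.
Qed.

(** Banach iteration from [x], with limits taken in R for each real and imaginary part. The iterates
    stay at distance at most [rho * r] from [x], and so does their limit. *)
Lemma moore_box_zero_exists :
  exists2 z, polymap f z = 0 & mxnorm (z - x) <= rho * r.
Proof.
pose it k := iter k (quasi_newton A) x.
have it_in k : mxnorm (it k - x) <= rho * r.
  elim: k => [|k IH]; first by rewrite subrr mxnorm0 mulr_ge0 // ltW.
  by apply: quasi_newton_maps; exact: le_trans IH rho_r.
have it_ball k : mxnorm (it k - x) <= r.
  exact: le_trans (it_in k) rho_r.
have itS k : mxnorm (it k.+1 - it k) <= r * rho ^+ k.
  elim: k => [|k IH].
    by rewrite expr0 mulr1; exact: it_ball.
  apply: le_trans (quasi_newton_lipschitz (it_ball k.+1) (it_ball k)) _.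
  by rewrite exprS mulrCA ler_wpM2l.
(* The sum of the geometric series that bounds the steps, so the k-th iterate is within
   [c * rho ^+ k] of the limit. *)
pose c := r / (1 - rho).
have c1 : c * (1 - rho) = r by rewrite divfK // gt_eqF // subr_gt0.
have c0 : 0 <= c by rewrite divr_ge0 ?subr_ge0 // ltW.
have lim (a : nat -> R) : (forall k, `|a k.+1 - a k| <= r * rho ^+ k) ->
    exists l, forall k, `|a k - l| <= c * rho ^+ k.
  move=> aS; apply: geometric_limit => //; first by rewrite rho_ge0.
  by move=> k; rewrite mulrAC c1.
have /choice[a aP] i : exists l, forall k, `|Re (it k i 0) - l| <= c * rho ^+ k.
  apply: lim => k; apply: le_trans _ (itS k); rewrite -raddfB.
  by have := le_mxnorm_Re (it k.+1 - it k) i 0; rewrite !mxE.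
have /choice[b bP] i : exists l, forall k, `|Im (it k i 0) - l| <= c * rho ^+ k.
  apply: lim => k; apply: le_trans _ (itS k); rewrite -raddfB.
  by have := le_mxnorm_Im (it k.+1 - it k) i 0; rewrite !mxE.
pose z : 'cV[R[i]]_n := \col_i Complex (a i) (b i).
have itz k : mxnorm (it k - z) <= c * rho ^+ k.
  apply/mxnormP; split=> [|i j]; first by rewrite mulr_ge0 ?exprn_ge0.
  by rewrite ord1 !mxE cReD cImD cReN cImN /= aP bP.
have small e : 0 < e -> exists k, c * rho ^+ k <= e.
  move=> e0; have /cvgrPdist_le : (fun k => c * rho ^+ k) @ \oo --> (c * 0 : R).
    by apply: cvgMr; apply: cvg_expr; rewrite ger0_norm.
  move=> /(_ _ e0)[k _ /(_ k (leqnn _))] /=.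
  by rewrite mulr0 sub0r normrN => ?; exists k; apply: le_trans (ler_norm _) _.
have zx : mxnorm (z - x) <= rho * r.
  apply/ler_addgt0Pr => e /small[k ke].
  apply: le_trans (mxnorm_distD (it k) _ _) _; rewrite addrC lerD //.
  by rewrite mxnorm_distC (le_trans (itz k)).
have zr := le_trans zx rho_r.
exists z => //; apply/(quasi_newton_fixedP zr)/subr0_eq/mxnorm_eq0.
apply/ler_addgt0Pr => e e0; rewrite add0r.
have e2 : 0 < e / 2 by rewrite divr_gt0.
have [k ke] := small _ e2.
apply: le_trans (mxnorm_distD (it k.+1) _ _) _; rewrite [e]splitr lerD //.
  apply: le_trans (quasi_newton_lipschitz zr (it_ball k)) _.
  rewrite mxnorm_distC (le_trans _ ke) // (le_trans _ (itz k)) //.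
  by rewrite ler_piMl ?mxnorm_ge0 // ltW.
apply: le_trans (itz k.+1) (le_trans _ ke).
apply: ler_wpM2l => //; rewrite exprS; apply: ler_piMl; last exact: ltW.
exact: exprn_ge0.
Qed.

End InABox.
End MooreBoxTheory.

(** * Interval arithmetic *)

Section Representable.
Variables (R : realType) (F : representable R).

Lemma repr0 : F 0.
Proof. by rewrite -(subrr (2^-1)); apply: reprB; exact: repr_half. Qed.

Lemma repr1 : F 1.
Proof. by rewrite [1]splitr mul1r; apply: reprD; exact: repr_half. Qed.

Lemma reprN a : F a -> F (- a).
Proof. by move=> Fa; rewrite -sub0r; apply: reprB => //; exact: repr0. Qed.

Lemma repr_hull a b : F a -> F b -> irepr F (ihull a b).
Proof.
by move=> Fa Fb; split=> /=; rewrite /Num.min /Num.max; case: ifP.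
Qed.

Lemma iopp_repr I : irepr F I -> irepr F (iopp I).
Proof. by move=> [Fl Fh]; apply: repr_hull; exact: reprN. Qed.

End Representable.

Section IntervalBounds.
Variable R : realType.
Implicit Types (I J : rint R) (Z W : cbox R).

Lemma lo_iopp I : lo (iopp I) = - hi I.
Proof. by apply/min_idPl; rewrite lerN2 lo_le_hi. Qed.

Lemma hi_iopp I : hi (iopp I) = - lo I.
Proof. by apply/max_idPr; rewrite lerN2 lo_le_hi. Qed.

Definition imag_le (c : R) I := - c <= lo I /\ hi I <= c.
Definition cmag_le c Z := imag_le c Z.1 /\ imag_le c Z.2.
Definition bmag_le m n c (X : 'M[cbox R]_(m, n)) := forall i j, cmag_le c (X i j).

(* Both the magnitude and the width, relatively to the scale e, are controlled
   by the single constant M: with u <= e this makes sums and products stable. *)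
Definition itame (M e : R) I := imag_le M I /\ hi I - lo I <= M * e.
Definition ctame M e Z := itame M e Z.1 /\ itame M e Z.2.
Definition btame m n M e (X : 'M[cbox R]_(m, n)) := forall i j, ctame M e (X i j).

Definition cin Z (z : R[i]) := iset Z.1 (Re z) /\ iset Z.2 (Im z).

Lemma imag_leW c d I : c <= d -> imag_le c I -> imag_le d I.
Proof. by rewrite /imag_le => cd [] *; split; lra. Qed.

Lemma cmag_leW c d Z : c <= d -> cmag_le c Z -> cmag_le d Z.
Proof. by move=> cd [] *; split; exact: imag_leW cd _. Qed.

Lemma itameW M N e I : 0 <= e -> M <= N -> itame M e I -> itame N e I.
Proof.
move=> e0 MN [Im Iw]; split; first exact: imag_leW MN _.
by have := ler_wpM2r e0 MN; lra.
Qed.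

Lemma ctameW M N e Z : 0 <= e -> M <= N -> ctame M e Z -> ctame N e Z.
Proof. by move=> e0 MN [] *; split; exact: itameW MN _. Qed.

Lemma btameW m n M N e (X : 'M[cbox R]_(m, n)) :
  0 <= e -> M <= N -> btame M e X -> btame N e X.
Proof. by move=> e0 MN X_t i j; exact: ctameW MN (X_t i j). Qed.

Lemma imag_iopp c I : imag_le c I -> imag_le c (iopp I).
Proof. by rewrite /imag_le lo_iopp hi_iopp => -[] *; split; lra. Qed.

Lemma itame_iopp M e I : itame M e I -> itame M e (iopp I).
Proof.
by move=> [/imag_iopp Im Iw]; split; rewrite // lo_iopp hi_iopp; lra.
Qed.

Lemma imag_le_sub c I : imag_le c I <-> iset I `<=` `[- c, c].
Proof.
split=> [[Il Ih] a /andP[la ah] /=|sub]; first by rewrite in_itv /=; lra.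
have /sub/= : iset I (lo I) by rewrite /iset /= lexx lo_le_hi.
have /sub/= : iset I (hi I) by rewrite /iset /= lexx lo_le_hi.
by rewrite !in_itv /= => /andP[_ ?] /andP[? _].
Qed.

Lemma in_iopp I a : iset I a -> iset (iopp I) (- a).
Proof.
by move=> /andP[? ?]; apply/andP; rewrite lo_iopp hi_iopp !lerN2.
Qed.

Lemma in_ihull (a b c : R) : a <= c <= b -> iset (ihull a b) c.
Proof. by rewrite /iset /= ge_min le_max => /andP[-> ->]; rewrite orbT. Qed.

Lemma in_iscale t I a : iset I a -> iset (Defs.iscale t I) (t * a).
Proof.
rewrite /iset /= ge_min le_max => /andP[la ah].
have [t0|/ltW t0] := leP 0 t.
  by rewrite (ler_wpM2l t0 la) (ler_wpM2l t0 ah) ?orbT.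
by rewrite (ler_wnM2l t0 la) (ler_wnM2l t0 ah) ?orbT.
Qed.

Lemma imag_iscale t c I : imag_le c I -> imag_le (`|t| * c) (Defs.iscale t I).
Proof.
move=> /imag_le_sub sub.
have bd a : iset I a -> `|t * a| <= `|t| * c.
  by move=> /sub /=; rewrite in_itv /= normrM -ler_norml; exact: ler_wpM2l.
have /bd : iset I (lo I) by rewrite /iset /= lexx lo_le_hi.
have /bd : iset I (hi I) by rewrite /iset /= lexx lo_le_hi.
rewrite !ler_norml => /andP[? ?] /andP[? ?].
by split; rewrite /= ?le_min ?ge_max; apply/andP.
Qed.

(** This transfers bounds on exact values to computed intervals: one small element and a small width
    make the whole interval small. *)
Lemma imag_le_in c d I a : iset I a -> `|a| <= c -> hi I - lo I <= d ->
  imag_le (c + d) I.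
Proof. by rewrite ler_norml => /andP[? ?] /andP[? ?] ?; split; lra. Qed.

Lemma cmag_le_in c M e Z z : cin Z z -> `|Re z| <= c -> `|Im z| <= c ->
  ctame M e Z -> cmag_le (c + M * e) Z.
Proof. by move=> [z1 z2] c1 c2 [[_ ?] [_ ?]]; split; apply: imag_le_in; eauto. Qed.

Lemma cin_cpt z : cin (cpt z) z.
Proof. by split; rewrite /iset /= lexx. Qed.

Lemma ctame_cpt M e z : 0 <= M * e -> `|Re z| <= M -> `|Im z| <= M ->
  ctame M e (cpt z).
Proof.
by move=> Me; rewrite !ler_norml => /andP[? ?] /andP[? ?]; split; split;
  rewrite /= ?subrr.
Qed.

End IntervalBounds.

(** * Norm and width of boxes *)

Section BoxNorms.
Variables (R : realType) (m n : nat).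
Implicit Types (X : 'M[cbox R]_(m, n)) (A B : 'M[R[i]]_(m, n)).

Lemma bmag_le_mxnorm c X A : 0 <= c -> bmag_le c X -> bset X A -> mxnorm A <= c.
Proof.
move=> c0 Xc XA; apply/mxnormP; split=> // i j.
have [/imag_le_sub s1 /imag_le_sub s2] := Xc i j.
have [/s1 + /s2] := XA i j.
by rewrite /= !in_itv /= !ler_norml.
Qed.

(** The suprema defining [bnorm] and [width] are meaningful only for bounded sets; the sum of all
    absolute values of endpoints is a crude bound. *)
Lemma bmag_le_ex X : exists2 c, 0 <= c & bmag_le c X.
Proof.
have le_sum k (G : 'I_k -> R) l : (forall l', 0 <= G l') -> G l <= \sum_l' G l'.
  by move=> G0; rewrite (bigD1 l) //= lerDl sumr_ge0.
pose c := \sum_i \sum_j (`|lo (X i j).1| + `|hi (X i j).1| +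
  (`|lo (X i j).2| + `|hi (X i j).2|)).
have pos i j : 0 <= `|lo (X i j).1| + `|hi (X i j).1| +
    (`|lo (X i j).2| + `|hi (X i j).2|) by rewrite !addr_ge0.
exists c; first by do 2 (apply: sumr_ge0 => ? _).
move=> i j; have : `|lo (X i j).1| + `|hi (X i j).1| +
  (`|lo (X i j).2| + `|hi (X i j).2|) <= c.
  apply: le_trans (le_sum _ _ j (pos i)) _.
  by apply: (le_sum _ _ i) => l; exact: sumr_ge0.
have := ler_norm (hi (X i j).1); have := ler_norm (hi (X i j).2).
have := ler_norm (- lo (X i j).1); have := ler_norm (- lo (X i j).2).
rewrite !normrN; have := normr_ge0 (hi (X i j).1).
have := normr_ge0 (hi (X i j).2); have := normr_ge0 (lo (X i j).1).
have := normr_ge0 (lo (X i j).2).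
by move=> *; split; split; lra.
Qed.

Lemma bset_nonempty X : exists A, bset X A.
Proof.
exists (\matrix_(i, j) Complex (lo (X i j).1) (lo (X i j).2)) => i j.
by rewrite mxE /iset /= !lexx !lo_le_hi.
Qed.

Lemma le_bnorm X A : bset X A -> mxnorm A <= bnorm X.
Proof.
move=> XA; apply: ub_le_sup; last by exists A.
have [c c0 Xc] := bmag_le_ex X.
by exists c => _ [B XB <-]; exact: bmag_le_mxnorm Xc XB.
Qed.

Lemma bnorm_le X c : (forall A, bset X A -> mxnorm A <= c) -> bnorm X <= c.
Proof.
move=> Xc; have [A XA] := bset_nonempty X.
by apply: ge_sup => [|_ [B XB <-]]; [exists (mxnorm A); exists A | exact: Xc].
Qed.

Lemma le_width X A B : bset X A -> bset X B -> mxnorm (A - B) <= width X.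
Proof.
move=> XA XB; apply: ub_le_sup; last by exists (A, B).
have [c c0 Xc] := bmag_le_ex X.
exists (c + c) => _ [[C D] /= [XC XD] <-].
by apply: le_trans (mxnormB _ _) _; rewrite lerD //; apply: bmag_le_mxnorm Xc _.
Qed.

Lemma width_le X M e : 0 <= M * e -> btame M e X -> width X <= M * e.
Proof.
move=> Me Xt; have [A XA] := bset_nonempty X.
apply: ge_sup => [|_ [[B C] /= [XB XC] <-]].
  by exists (mxnorm (A - A)); exists (A, A).
apply/mxnormP; split=> // i j; rewrite !mxE !cE.
have [/andP[? ?] /andP[? ?]] := XB i j; have [/andP[? ?] /andP[? ?]] := XC i j.
by have [[_ ?] [_ ?]] := Xt i j; split; rewrite ler_norml; lra.
Qed.

End BoxNorms.

(** * Rounded operations on intervals and complex boxes *)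

Section IntervalOperations.
Variables (R : realType) (F : representable R) (ia : interval_arith F) (u : R).
Hypothesis u_itv : 0 < u < 1.
Implicit Types (I J : rint R) (Z W : cbox R).

Let u_gt0 : 0 < u. Proof. by case/andP: u_itv. Qed.
Let u_lt1 : u < 1. Proof. by case/andP: u_itv. Qed.

Lemma iadd_bounds M I J : 1 <= M -> imag_le M I -> imag_le M J ->
  lo I + lo J - M * u <= lo (iadd ia u I J) /\
  hi (iadd ia u I J) <= hi I + hi J + M * u.
Proof.
move=> M1 /imag_le_sub IM /imag_le_sub JM.
have sub := @iadd_err _ _ ia _ _ _ _ u_itv M1 IM JM.
have /sub/= : iset (iadd ia u I J) (lo (iadd ia u I J)).
  by rewrite /iset /= lexx lo_le_hi.
have /sub/= : iset (iadd ia u I J) (hi (iadd ia u I J)).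
  by rewrite /iset /= lexx lo_le_hi.
by rewrite !in_itv /= => /andP[_ ?] /andP[? _].
Qed.

(** Common bounds [a] and [b] on the four corner products replace the nested minima and maxima, for
    magnitudes and widths alike. *)
Lemma imul_bounds M I J (a b : R) : 1 <= M -> irepr F I -> irepr F J ->
  imag_le M I -> imag_le M J ->
  (forall p q, p = lo I \/ p = hi I -> q = lo J \/ q = hi J -> a <= p * q <= b) ->
  a - M ^+ 2 * u <= lo (imul ia u I J) /\
  hi (imul ia u I J) <= b + M ^+ 2 * u.
Proof.
move=> M1 FI FJ /imag_le_sub IM /imag_le_sub JM ab.
have sub := @imul_err _ _ ia _ _ _ _ u_itv M1 FI FJ IM JM.
have /sub/= : iset (imul ia u I J) (lo (imul ia u I J)).
  by rewrite /iset /= lexx lo_le_hi.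
have /sub/= : iset (imul ia u I J) (hi (imul ia u I J)).
  by rewrite /iset /= lexx lo_le_hi.
rewrite !in_itv /= => /andP[_ h1] /andP[h2 _]; split.
  by apply: le_trans h2; rewrite lerD2r !le_min -!andbA; apply/and4P;
    split; apply: (andP (ab _ _ _ _)).1; eauto.
by apply: (le_trans h1); rewrite lerD2r !ge_max -!andbA; apply/and4P;
  split; apply: (andP (ab _ _ _ _)).2; eauto.
Qed.

Lemma iadd_mag M a b I J : 1 <= M -> a <= M -> b <= M ->
  imag_le a I -> imag_le b J -> imag_le (a + b + M * u) (iadd ia u I J).
Proof.
move=> M1 aM bM Ia Jb.
have [] := iadd_bounds M1 (imag_leW aM Ia) (imag_leW bM Jb).
by case: Ia Jb => ? ? [? ?] ? ?; split; lra.
Qed.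

Lemma imul_mag M a b I J : 1 <= M -> 0 <= a <= M -> 0 <= b <= M ->
  irepr F I -> irepr F J -> imag_le a I -> imag_le b J ->
  imag_le (a * b + M ^+ 2 * u) (imul ia u I J).
Proof.
move=> M1 /andP[a0 aM] /andP[b0 bM] FI FJ Ia Jb.
have corner p q : p = lo I \/ p = hi I -> q = lo J \/ q = hi J ->
    - (a * b) <= p * q <= a * b.
  move=> pI qJ; rewrite -ler_norml normrM ler_pM // ler_norml.
    by have := lo_le_hi I; case: Ia pI => ? ? [] -> ?; lra.
  by have := lo_le_hi J; case: Jb qJ => ? ? [] -> ?; lra.
have [? ?] := imul_bounds M1 FI FJ (imag_leW aM Ia) (imag_leW bM Jb) corner.
by split; lra.
Qed.

(** The factor 4 comes from the width: two widths [M * e] and a roundoff [M * u] at each end. *)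
Lemma iadd_tame M e I J : 1 <= M -> u <= e -> itame M e I -> itame M e J ->
  itame (4 * M) e (iadd ia u I J).
Proof.
have u0 := u_gt0; have u1 := u_lt1.
move=> M1 ue [Im Iw] [Jm Jw].
have [h1 h2] := iadd_bounds M1 Im Jm.
have Mue : M * u <= M * e by apply: ler_wpM2l ue; lra.
have MuM : M * u <= M by rewrite ler_piMr //; lra.
by case: Im Jm => ? ? [? ?]; split; [split|]; lra.
Qed.

(** All corner products are within 2 M^2 e of the product of the lower ends; this spread of 4 M^2 e
    and two roundoffs M^2 u give the factor 6. *)
Lemma imul_tame M e I J : 1 <= M -> u <= e -> irepr F I -> irepr F J ->
  itame M e I -> itame M e J -> itame (6 * M ^+ 2) e (imul ia u I J).
Proof.
have u0 := u_gt0; have u1 := u_lt1.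
move=> M1 ue FI FJ [Im Iw] [Jm Jw].
have M0 : 0 <= M by lra.
have MM : 0 <= M <= M by rewrite M0 lexx.
have [h1 h2] := imul_mag M1 MM MM FI FJ Im Jm.
have M2ue : M ^+ 2 * u <= M ^+ 2 * e by apply: ler_wpM2l ue; rewrite exprn_ge0.
have M2u : M ^+ 2 * u <= M ^+ 2 by rewrite ler_piMr ?exprn_ge0 // ltW.
have M2E : M * M = M ^+ 2 by [].
have M20 : 0 <= M ^+ 2 by rewrite exprn_ge0.
have Ml : 0 <= hi I - lo I by rewrite subr_ge0 lo_le_hi.
have Jl : 0 <= hi J - lo J by rewrite subr_ge0 lo_le_hi.
have near p q : p = lo I \/ p = hi I -> q = lo J \/ q = hi J ->
    lo I * lo J - 2 * (M ^+ 2 * e) <= p * q <= lo I * lo J + 2 * (M ^+ 2 * e).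
  move=> pI qJ; rewrite -ler_distl.
  have -> : p * q - lo I * lo J = p * (q - lo J) + (p - lo I) * lo J by ring.
  have -> : 2 * (M ^+ 2 * e) = M * (M * e) + M * e * M by ring.
  apply: le_trans (ler_normD _ _) _; rewrite !normrM lerD // ler_pM // ler_norml.
  - by case: Im pI => ? ? [] ->; lra.
  - by case: qJ => ->; lra.
  - by case: pI => ->; lra.
  - by case: Jm => ? ?; lra.
have [g1 g2] := imul_bounds M1 FI FJ Im Jm near.
by split; [split|]; lra.
Qed.

Lemma cadd_in Z W z w : cin Z z -> cin W w -> cin (cadd ia u Z W) (z + w).
Proof.
by move=> [? ?] [? ?]; split; rewrite ?cReD ?cImD; exact: iadd_in.
Qed.

Definition crep Z := irepr F Z.1 /\ irepr F Z.2.

Lemma cadd_repr Z W : crep Z -> crep W -> crep (cadd ia u Z W).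
Proof. by move=> [? ?] [? ?]; split; exact: iadd_repr. Qed.

Lemma copp_repr Z : crep Z -> crep (copp Z).
Proof. by move=> [? ?]; split; exact: iopp_repr. Qed.

Lemma copp_in Z z : cin Z z -> cin (copp Z) (- z).
Proof. by move=> [? ?]; split; rewrite ?cReN ?cImN; exact: in_iopp. Qed.

Lemma cpt_repr (z : R[i]) : crepr F z -> crep (cpt z).
Proof. by move=> []; split; split. Qed.

Lemma cmul_repr Z W : crep Z -> crep W -> crep (cmul ia u Z W).
Proof.
move=> [? ?] [? ?]; split; apply: iadd_repr => //; try exact: imul_repr.
by apply: iopp_repr; exact: imul_repr.
Qed.

Lemma cmul_in Z W z w : crep Z -> crep W -> cin Z z -> cin W w ->
  cin (cmul ia u Z W) (z * w).
Proof.
move=> [? ?] [? ?] [? ?] [? ?]; split; rewrite ?cReM ?cImM; apply: iadd_in => //.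
- exact: imul_in.
- by apply: in_iopp; exact: imul_in.
- exact: imul_in.
- exact: imul_in.
Qed.

Lemma cadd_tame M e Z W : 1 <= M -> u <= e -> ctame M e Z -> ctame M e W ->
  ctame (4 * M) e (cadd ia u Z W).
Proof. by move=> ? ? [? ?] [? ?]; split; exact: iadd_tame. Qed.

Lemma copp_tame M e Z : ctame M e Z -> ctame M e (copp Z).
Proof. by move=> [? ?]; split; exact: itame_iopp. Qed.

Lemma cmul_tame M e Z W : 1 <= M -> u <= e -> crep Z -> crep W ->
  ctame M e Z -> ctame M e W -> ctame (24 * M ^+ 2) e (cmul ia u Z W).
Proof.
move=> M1 ue [? ?] [? ?] [? ?] [? ?].
have -> : 24 * M ^+ 2 = 4 * (6 * M ^+ 2) by ring.
have M21 : 1 <= 6 * M ^+ 2 by have := exprn_ege1 2 M1; lra.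
split; apply: iadd_tame => //; try exact: imul_tame.
by apply: itame_iopp; exact: imul_tame.
Qed.

Lemma cadd_mag C e Z W : 1 <= C -> u <= e <= 1 ->
  cmag_le (C * e) Z -> cmag_le (C * e) W -> cmag_le (4 * C * e) (cadd ia u Z W).
Proof.
have u0 := u_gt0; have u1 := u_lt1.
move=> C1 /andP[ue e1] [z1 z2] [w1 w2].
have CeC : C * e <= C by rewrite ler_piMr //; lra.
have Cu : C * u <= C * e by apply: ler_wpM2l; lra.
have Ce0 : 0 <= C * e by rewrite mulr_ge0 //; lra.
have le4 : C * e + C * e + C * u <= 4 * C * e.
  by lra.
by split; apply: imag_leW le4 _; exact: iadd_mag.
Qed.

(** A factor of size O(e) times a factor of size 1 stays O(e), because the roundoff is itself at
    most [e]. This is the case of the product of I - U df by the unit ball. *)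
Lemma cmul_mag C e Z W : 1 <= C -> u <= e <= 1 -> crep Z -> crep W ->
  cmag_le (C * e) Z -> cmag_le 1 W -> cmag_le (8 * C ^+ 2 * e) (cmul ia u Z W).
Proof.
have u0 := u_gt0; have u1 := u_lt1.
move=> C1 /andP[ue e1] [? ?] [? ?] [? ?] [? ?].
have CeC : 0 <= C * e <= C.
  by apply/andP; split; [apply: mulr_ge0 | rewrite ler_piMr //]; lra.
have C01 : (0 : R) <= 1 <= C by rewrite ler01.
have -> : 8 * C ^+ 2 * e = 4 * (2 * C ^+ 2) * e by ring.
have C21 := exprn_ege1 2 C1.
have le2 : C * e * 1 + C ^+ 2 * u <= 2 * C ^+ 2 * e.
  have -> : 2 * C ^+ 2 * e = C ^+ 2 * e + C ^+ 2 * e by ring.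
  rewrite mulr1 lerD //; last by apply: ler_wpM2l ue; lra.
  by rewrite ler_wpM2r ?ler_eXnr //; lra.
have mul_mag I J : irepr F I -> irepr F J -> imag_le (C * e) I -> imag_le 1 J ->
    imag_le (2 * C ^+ 2 * e) (imul ia u I J).
  by move=> ? ? ? ?; apply: imag_leW le2 _; exact: imul_mag.
have -> : cmul ia u Z W = cadd ia u (imul ia u Z.1 W.1, imul ia u Z.1 W.2)
    (iopp (imul ia u Z.2 W.2), imul ia u Z.2 W.1) by [].
apply: cadd_mag; rewrite ?ue //; first by lra.
  by split; exact: mul_mag.
by split; [apply: imag_iopp|]; exact: mul_mag.
Qed.

Lemma csum_in (K : Type) (s : seq K) (G : K -> cbox R) (g : K -> R[i]) :
  (forall k, cin (G k) (g k)) -> cin (csum ia u (map G s)) (\sum_(k <- s) g k).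
Proof.
move=> Gg; case: s => [|k s] /=; first by rewrite big_nil; exact: cin_cpt.
rewrite big_cons; elim: s (G k) (g k) (Gg k) => [|l s IH] Z z Zz /=.
  by rewrite big_nil addr0.
by rewrite big_cons addrA; apply: IH; exact: cadd_in.
Qed.

(** Each addition multiplies the controlling constant by 4, whence the power of 4. The predicate [P]
    is instantiated by tameness, by magnitude, and by representability, which ignores the
    constant. *)
Lemma csum_ind (K : Type) (P : R -> cbox R -> Prop) (s : seq K) (G : K -> cbox R) b :
  (forall c Z W, 1 <= c -> P c Z -> P c W -> P (4 * c) (cadd ia u Z W)) ->
  (forall c d Z, c <= d -> P c Z -> P d Z) -> P 1 (cpt 0) -> 1 <= b ->
  (forall k, P b (G k)) -> P (4 ^+ size s * b) (csum ia u (map G s)).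
Proof.
move=> Padd PW P0 b1 PG; case: s => [|k s] /=.
  by rewrite expr0 mul1r; exact: PW P0.
have four : (1 : R) <= 4 by rewrite ler1n.
suff H d Z : b <= d -> P d Z -> P (4 ^+ size s * d) (foldl (cadd ia u) Z (map G s)).
  apply: PW (H b _ (lexx b) (PG k)); rewrite exprS -mulrA ler_peMl //.
  by rewrite mulr_ge0 ?exprn_ge0 // (le_trans ler01).
elim: s d Z => [|l s IH] d Z bd PZ /=; first by rewrite expr0 mul1r.
rewrite exprSr -mulrA; apply: IH.
  by rewrite (le_trans bd) // ler_peMl // (le_trans (le_trans ler01 b1)).
by apply: Padd => //; [exact: le_trans bd | exact: PW (PG l)].
Qed.

End IntervalOperations.

Section BoxOperations.
Variables (R : realType) (F : representable R) (ia : interval_arith F) (u : R).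
Hypothesis u_itv : 0 < u < 1.

Lemma bpt_in m n (A : 'M[R[i]]_(m, n)) : bset (bpt A) A.
Proof. by move=> i j; rewrite mxE; exact: cin_cpt. Qed.

Lemma bpt_repr m n (A : 'M[R[i]]_(m, n)) : mx_repr F A -> box_repr F (bpt A).
Proof. by move=> FA i j; rewrite mxE; exact: cpt_repr (FA i j). Qed.

Lemma bpt_tame m n (A : 'M[R[i]]_(m, n)) M e : 0 <= e -> mxnorm A <= M ->
  btame M e (bpt A).
Proof.
move=> e0 AM i j; rewrite mxE; apply: ctame_cpt.
- by rewrite mulr_ge0 // (le_trans (mxnorm_ge0 A)).
- exact: le_trans (le_mxnorm_Re A i j) AM.
- exact: le_trans (le_mxnorm_Im A i j) AM.
Qed.

Lemma bsub_in m n (X Y : 'M[cbox R]_(m, n)) A B : bset X A -> bset Y B ->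
  bset (bsub ia u X Y) (A - B).
Proof.
move=> XA YB i j; rewrite !mxE.
by apply: cadd_in => //; apply: copp_in.
Qed.

Lemma bsub_repr m n (X Y : 'M[cbox R]_(m, n)) : box_repr F X -> box_repr F Y ->
  box_repr F (bsub ia u X Y).
Proof.
move=> FX FY i j; rewrite !mxE.
by apply: cadd_repr => //; apply: copp_repr.
Qed.

Lemma bsub_tame m n (X Y : 'M[cbox R]_(m, n)) M e : 1 <= M -> u <= e ->
  btame M e X -> btame M e Y -> btame (4 * M) e (bsub ia u X Y).
Proof.
move=> M1 ue X_t Y_t i j; rewrite !mxE.
by apply: cadd_tame => //; exact: copp_tame.
Qed.

Section Products.
Variables (m n p : nat) (X : 'M[cbox R]_(m, n)) (Y : 'M[cbox R]_(n, p)).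
Hypotheses (FX : box_repr F X) (FY : box_repr F Y).

Lemma bmul_in A B : bset X A -> bset Y B -> bset (bmul ia u X Y) (A *m B).
Proof.
move=> XA YB i j; rewrite !mxE -big_enum; apply: csum_in => // k.
by apply: cmul_in.
Qed.

Lemma bmul_repr : box_repr F (bmul ia u X Y).
Proof.
move=> i j; rewrite mxE.
apply: (@csum_ind _ _ ia u _ (fun _ => crep F) _ _ 1) => // [? ? ? _||k].

- exact: cadd_repr.
- by apply: cpt_repr; split; exact: repr0.
- by apply: cmul_repr.
Qed.

Lemma bmul_tame M e : 1 <= M -> u <= e -> btame M e X -> btame M e Y ->
  btame (4 ^+ n * (24 * M ^+ 2)) e (bmul ia u X Y).
Proof.
move=> M1 ue X_t Y_t i j; have e0 : 0 <= e by case/andP: u_itv => ? _; lra.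
rewrite mxE -[n in 4 ^+ n]size_enum_ord.
apply: (@csum_ind _ _ ia u _ (fun c => ctame c e)) => [c Z W||||k].
- by move=> c1; exact: cadd_tame.
- by move=> c d Z; exact: ctameW.
- by apply: ctame_cpt; rewrite ?mul1r //= normr0.
- by have := exprn_ege1 2 M1; lra.
- by apply: cmul_tame.
Qed.

Lemma bmul_mag C e : 1 <= C -> u <= e <= 1 -> bmag_le (C * e) X -> bmag_le 1 Y ->
  bmag_le (4 ^+ n * (8 * C ^+ 2) * e) (bmul ia u X Y).
Proof.
move=> C1 ue X_c Y_1 i j.
have e0 : 0 <= e by case/andP: u_itv ue => ? _ /andP[? _]; lra.
rewrite mxE -[n in 4 ^+ n]size_enum_ord.
apply: (@csum_ind _ _ ia u _ (fun c => cmag_le (c * e))) => [c Z W||||k].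
- by move=> c1; exact: cadd_mag.
- by move=> c d Z cd; apply: cmag_leW; rewrite ler_wpM2r.
- by split; split => /=; lra.
- by have := exprn_ege1 2 C1; lra.
- by apply: cmul_mag.
Qed.

End Products.

Lemma bball_in n (x z : 'cV[R[i]]_n) r : mxnorm (z - x) <= r ->
  bset (bball x r) z.
Proof.
move=> /mxnormP[_ zx] i j; have := zx i 0; rewrite !mxE !cE ord1 !ler_norml.
by move=> [/andP[? ?] /andP[? ?]]; split; apply: in_ihull; apply/andP; split; lra.
Qed.

Lemma bball_repr n (x : 'cV[R[i]]_n) r : mx_repr F x -> F r ->
  box_repr F (bball x r).
Proof.
move=> Fx Fr i j; rewrite mxE; have [? ?] := Fx i 0.
by split; apply: repr_hull; (apply: reprB || apply: reprD).
Qed.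

Lemma bball_tame n (x : 'cV[R[i]]_n) M r e : 0 <= r -> mxnorm x <= M -> r <= e ->
  e <= 1 -> btame (M + 2) e (bball x r).
Proof.
move=> r0 /mxnormP[M0 xM] re e1 i j; rewrite mxE.
have [] := xM i 0; rewrite !ler_norml => /andP[? ?] /andP[? ?].
have Me : 0 <= M * e by apply: mulr_ge0; lra.
split; split; rewrite /imag_le /= ?(min_idPl _) ?(max_idPr _); try split; lra.
Qed.

End BoxOperations.

(** * Natural interval extensions of circuits *)

Section Circuits.
Variables (R : realType) (F : representable R) (ia : interval_arith F) (n : nat).

Lemma eval_box_repr u N (c : circuit R[i] n N) (X : 'cV[cbox R]_n) k :
  0 < u < 1 -> consts_in (crepr F) c -> box_repr F X ->
  crep F (Defs.eval (cadd ia u) (cmul ia u) (@cpt R) (fun j => X j 0) c k).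
Proof.
move=> u_itv + FX; elim: c k => [[]//|{}N c IH g] k /= [/IH{}IH gc].
case: unlift => [k'|]; first exact: IH.
case: g gc => [i|a|a b|a b] /= gc.
- exact: FX.
- exact: cpt_repr.
- exact: cadd_repr.
- exact: cmul_repr.
Qed.

Lemma eval_box_in u N (c : circuit R[i] n N) (X : 'cV[cbox R]_n) x k :
  0 < u < 1 -> consts_in (crepr F) c -> box_repr F X -> bset X x ->
  cin (Defs.eval (cadd ia u) (cmul ia u) (@cpt R) (fun j => X j 0) c k)
      (Defs.eval +%R *%R id (fun j => x j 0) c k).
Proof.
move=> u_itv + FX Xx; elim: c k => [[]//|{}N c IH g] k /= [Fc gc].
case: unlift => [k'|]; first exact: IH.
case: g gc => [i|a|a b|a b] /= gc.
- exact: Xx.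
- exact: cin_cpt.
- by apply: cadd_in => //; exact: IH.
- by apply: cmul_in => //; (exact: IH || exact: eval_box_repr).
Qed.

(** The order of quantifiers is the point: [M'] depends on the circuit and on [M] only, hence is
    uniform in the precision, the scale and the box. *)
Lemma eval_box_tame N (c : circuit R[i] n N) (M : R) :
  1 <= M -> consts_in (crepr F) c -> exists2 M', M <= M' &
  forall u e (X : 'cV[cbox R]_n) k, 0 < u < 1 -> u <= e -> box_repr F X ->
    btame M e X ->
    ctame M' e (Defs.eval (cadd ia u) (cmul ia u) (@cpt R) (fun j => X j 0) c k).
Proof.
move=> M1; elim: c => [|{}N c IH g] /=; first by exists M => // ? ? ? [].
move=> [Fc gc]; have [M' MM' tame] := IH Fc.
have M'1 : 1 <= M' by exact: le_trans M1 MM'.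
pose cst := if g is Const a then `|Re a| + `|Im a| else 0.
have cst0 : 0 <= cst by rewrite /cst; case: (g) => // a; rewrite addr_ge0.
have M2 : M' <= M' ^+ 2 by rewrite ler_eXnr.
(* This dominates [4 * M'] for an addition, the product bound, and the size [cst] of a constant at
   the new node. *)
exists (24 * M' ^+ 2 + cst); first by lra.
move=> u e X k u_itv ue FX X_t.
have e0 : 0 <= e by case/andP: u_itv => ? _; lra.
have tame_c l := tame _ _ _ l u_itv ue FX X_t.
case: unlift => [k'|]; first by apply: ctameW (tame_c k') => //; lra.
case: g gc @cst cst0 => [i|a|a b|a b] /= gc cst0.
- by apply: ctameW (X_t i 0) => //; lra.
- apply: ctame_cpt; first by apply: mulr_ge0 => //; lra.
    by have := normr_ge0 (Im a); lra.
  by have := normr_ge0 (Re a); lra.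
- by apply: ctameW (cadd_tame ia u_itv M'1 ue (tame_c a) (tame_c b)) => //; lra.
- have := cmul_tame ia u_itv M'1 ue _ _ (tame_c a) (tame_c b).
  by rewrite addr0; apply; exact: eval_box_repr.
Qed.

Section BoxMaps.
Variables (cf : circuit_map R n 'I_n) (cdf : circuit_map R n ('I_n * 'I_n)%type).
Hypotheses (cf_repr : consts_in (crepr F) (cm_circuit cf))
  (cdf_repr : consts_in (crepr F) (cm_circuit cdf)).
Variable f : 'I_n -> mpoly n R[i].
Hypotheses (cfE : forall x i, cm_eval cf x i = polymap f x i 0)
  (cdfE : forall x i j, cm_eval cdf x (i, j) = jacobian f x i j).

Lemma box_map_in u X x : 0 < u < 1 -> box_repr F X -> bset X x ->
  bset (box_map ia u cf X) (polymap f x).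
Proof. by move=> ? ? ? i j; rewrite ord1 -cfE mxE; exact: eval_box_in. Qed.

Lemma box_map_repr u X : 0 < u < 1 -> box_repr F X ->
  box_repr F (box_map ia u cf X).
Proof. by move=> ? ? i j; rewrite mxE; exact: eval_box_repr. Qed.

Lemma box_map_tame M : 1 <= M -> exists2 M', M <= M' &
  forall u e X, 0 < u < 1 -> u <= e -> box_repr F X -> btame M e X ->
    btame M' e (box_map ia u cf X).
Proof.
move=> /eval_box_tame /(_ cf_repr)[M' MM' tame]; exists M' => // u e X *.
by move=> i j; rewrite mxE; exact: tame.
Qed.

Lemma box_jacobian_in u X x : 0 < u < 1 -> box_repr F X -> bset X x ->
  bset (box_jacobian ia u cdf X) (jacobian f x).
Proof. by move=> ? ? ? i j; rewrite -cdfE mxE; exact: eval_box_in. Qed.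

Lemma box_jacobian_repr u X : 0 < u < 1 -> box_repr F X ->
  box_repr F (box_jacobian ia u cdf X).
Proof. by move=> ? ? i j; rewrite mxE; exact: eval_box_repr. Qed.

Lemma box_jacobian_tame M : 1 <= M -> exists2 M', M <= M' &
  forall u e X, 0 < u < 1 -> u <= e -> box_repr F X -> btame M e X ->
    btame M' e (box_jacobian ia u cdf X).
Proof.
move=> /eval_box_tame /(_ cdf_repr)[M' MM' tame]; exists M' => // u e X *.
by move=> i j; rewrite mxE; exact: tame.
Qed.

End BoxMaps.
End Circuits.

(** * Compactness and limits *)

Section Compactness.
Variables (R : realType) (n : nat).

Lemma ball_complex (z w e : R[i]) : 0 < e ->
  `|Re z - Re w| < Re e / 2 -> `|Im z - Im w| < Re e / 2 ->
  ball (z : (R[i] : numFieldType)) e w.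
Proof.
move=> e0 zr zi; rewrite -ball_normE /ball_ /=.
have eE : e = (Re e)%:C.
  by case: (e) e0 => er ei; rewrite ltcE /= => /andP[/eqP->].
rewrite eE normc_def ltcR cReD cImD cReN cImN.
apply: (@le_lt_trans _ _ (`|Re z - Re w| + `|Im z - Im w|)); last first.
  by rewrite [X in _ < X]splitr ltrD.
set a := Re z - Re w; set b := Im z - Im w.
rewrite -[leRHS]ger0_norm ?addr_ge0 // -sqrtr_sqr ler_wsqrtr //.
rewrite [leRHS]sqrrD -(real_normK (num_real a)) -(real_normK (num_real b)).
by rewrite lerD2r lerDl mulrn_wge0 // mulr_ge0.
Qed.

Lemma ultra_cvg_segment (T : Type) (G : set_system T) (GU : UltraFilter G)
  (h : T -> R) (a b : R) : G [set y | a <= h y <= b] ->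
  exists2 l, a <= l <= b & h @ G --> l.
Proof.
move=> Gab; have hG : (h @ G) [set` `[a, b]].
  by rewrite /fmap /=; apply: filterS Gab => y; rewrite /= in_itv.
have [l [/= + hl]] := @segment_compact R a b _ _ hG.
rewrite in_itv /= => lab; exists l => // B lB.
have [//|GB] := in_ultra_setVsetC (h @^-1` B) GU.
by have [t [nB Bt]] := hl (~` B) B GB lB; case: (nB Bt).
Qed.

(** The accuracy of [uinv] is uniform on compact sets, hence the need for compactness. Under an
    ultrafilter containing the ball, each real and imaginary part converges in a segment; finitely
    many coordinates then converge together. *)
Lemma compact_moore_ball (x : 'cV[R[i]]_n) (r : R) :
  compact ([set y | mxnorm (y - x) <= r] : set 'cV[(R[i] : numFieldType)]_n).
Proof.
rewrite compact_ultra => G GU Gball.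
have lim (h : R[i] -> R) i : (forall z w, `|h z - h w| <= `|h (z - w)|) ->
    (forall A : 'cV[R[i]]_n, `|h (A i 0)| <= mxnorm A) ->
    exists2 l, `|l - h (x i 0)| <= r & (fun y : 'cV[R[i]]_n => h (y i 0)) @ G --> l.
  move=> hB hle.
  have [|l] := @ultra_cvg_segment _ G GU (fun y => h (y i 0))
    (h (x i 0) - r) (h (x i 0) + r); last by rewrite -ler_distl; exists l.
  apply: filterS Gball => y /= yx; rewrite -ler_distl.
  apply: le_trans (hB _ _) (le_trans _ yx).
  by have := hle (y - x); rewrite !mxE.
have /choice[a aP] i : exists l, `|l - Re (x i 0)| <= r /\
    (fun y : 'cV[R[i]]_n => Re (y i 0)) @ G --> l.
  have [z w|A|l ? ?] := lim (@complex.Re R) i; last by exists l.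
    by rewrite !cE.
  exact: le_mxnorm_Re.
have /choice[b bP] i : exists l, `|l - Im (x i 0)| <= r /\
    (fun y : 'cV[R[i]]_n => Im (y i 0)) @ G --> l.
  have [z w|A|l ? ?] := lim (@complex.Im R) i; last by exists l.
    by rewrite !cE.
  exact: le_mxnorm_Im.
exists (\col_i Complex (a i) (b i)); split=> [|B /nbhs_ballP[e /= e0 eB]].
  have [y /= yx] := filter_ex Gball; apply/mxnormP.
  split=> [|i j]; first exact: le_trans (mxnorm_ge0 _) yx.
  by rewrite ord1 !mxE !cE /=; split; [case: (aP i) | case: (bP i)].
have e2 : 0 < Re e / 2 by move: e0; rewrite ltcE => /andP[_ ?]; rewrite divr_gt0.
apply: filterS eB _.
have near_i (h : R[i] -> R) (c : 'I_n -> R) :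
    (forall i, (fun y : 'cV[R[i]]_n => h (y i 0)) @ G --> c i) ->
    \forall y \near G, forall i, `|c i - h ((y : 'cV[R[i]]_n) i 0)| < Re e / 2.
  by move=> hc; apply: filter_forall => i; move/cvgrPdist_lt : (hc i); exact.
have := near_i _ _ (fun i => (aP i).2); have := near_i _ _ (fun i => (bP i).2).
apply: filterS2 => y yb ya; split=> // i j.
by rewrite ord1 mxE; apply: ball_complex => //=.
Qed.

End Compactness.

Section NearZero.
Variable R : realType.

Lemma nbhs_right0_ex (P : R -> Prop) : (\forall u \near 0^'+, P u) ->
  exists2 d : R, 0 < d & forall u, 0 < u < d -> P u.
Proof.
move=> /nbhs_ballP[d /= d0 dP]; exists d => // u /andP[u0 ud].
apply: (dP _ _ u0); rewrite -ball_normE /ball_ /=.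
by rewrite sub0r normrN gtr0_norm.
Qed.

Lemma omega_le (prec : precision_control R) (e : R) : 0 < e ->
  exists2 d, 0 < d & forall s, 0 < s < d -> omega prec s <= e * s.
Proof.
move=> e0; have /cvgrPdist_le/(_ e e0)/nbhs_right0_ex[d d0 dP] :=
  @omega_littleo _ prec.
exists d => // s sd; have := dP s sd; case/andP: sd => s0 _.
have /andP[w0 _] := omega_itv prec s0.
by rewrite sub0r normrN ger0_norm ?ler_pdivrMr // divr_ge0 // ltW.
Qed.

Lemma incr_prec_small (prec : precision_control R) (u : nat -> R) (e : R) :
  0 < e -> 0 < u 0 < 1 -> (forall k, u k.+1 = incr_prec prec (u k)) ->
  exists k, u k <= e.
Proof.
move=> e0 u0 uS.
have u_itv k : 0 < u k < 1.
  elim: k => // k IH; rewrite uS.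
  have /andP[-> /le_lt_trans -> //] := incr_prec_le prec IH.
  by case/andP: IH.
have : u k @[k --> \oo] --> 0.
  apply: (incr_prec_cvg (p := prec)) => // [|k]; last by exists k.
  apply/nonincreasing_seqP => k; rewrite uS.
  by case/andP: (incr_prec_le prec (u_itv k)).
move=> /cvgrPdist_le/(_ e e0)[k _ /(_ k (leqnn _))] /=.
by rewrite sub0r normrN => ke; exists k; apply: le_trans (ler_norm _) ke.
Qed.

Lemma uinv_close (F : representable R) n f (ui : @unchecked_inverse R F n f)
    (x : 'cV[R[i]]_n) (r e : R) : 0 < e ->
  (forall y, mxnorm (y - x) <= r -> jacobian f y \in unitmx) ->
  exists2 d, 0 < d & forall u y, 0 < u < d -> mxnorm (y - x) <= r ->
    mx_repr F y -> mxnorm (ui u y - invmx (jacobian f y)) <= e.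
Proof.
move=> e0 unit_y.
have /nbhs_right0_ex[d d0 dP] := uinv_cvg ui (@compact_moore_ball R n x r) unit_y e0.
by exists d => // u y /dP; apply.
Qed.

End NearZero.

(** * The test M *)

Section MooreTest.
Variables (R : realType) (F : representable R) (ia : interval_arith F) (n : nat).
Variables (cf : circuit_map R n 'I_n) (cdf : circuit_map R n ('I_n * 'I_n)%type).
Hypotheses (cf_repr : consts_in (crepr F) (cm_circuit cf))
  (cdf_repr : consts_in (crepr F) (cm_circuit cdf)).
Variable f : 'I_n -> mpoly n R[i].
Hypotheses (cfE : forall x i, cm_eval cf x i = polymap f x i 0)
  (cdfE : forall x i j, cm_eval cdf x (i, j) = jacobian f x i j).

Lemma box_residual_in u y (A : 'M[R[i]]_n) :
  0 < u < 1 -> mx_repr F y -> mx_repr F A ->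
  bset (bmul ia u (bpt A) (box_map ia u cf (bpt y))) (A *m polymap f y).
Proof.
move=> u_itv Fy FA; apply: bmul_in => //.
- exact: bpt_repr.
- by apply: box_map_repr => //; exact: bpt_repr.
- exact: bpt_in.
- by apply: (box_map_in ia cf_repr cfE) => //; [exact: bpt_repr | exact: bpt_in].
Qed.

Lemma box_residual_repr u y (A : 'M[R[i]]_n) :
  0 < u < 1 -> mx_repr F y -> mx_repr F A ->
  box_repr F (bmul ia u (bpt A) (box_map ia u cf (bpt y))).
Proof.
move=> u_itv Fy FA; apply: bmul_repr => //; first exact: bpt_repr.
by apply: box_map_repr => //; exact: bpt_repr.
Qed.

Lemma mx_repr1 : mx_repr F (1%:M : 'M[R[i]]_n).
Proof.
move=> i j; rewrite mxE; case: (i == j); split => /=;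
  by [exact: repr1 | exact: repr0].
Qed.

Lemma mxnorm1 : mxnorm (1%:M : 'M[R[i]]_n) <= 1.
Proof.
apply/mxnormP; split=> // i j; rewrite mxE.
by case: (i == j); rewrite /= ?normr0 ?normr1.
Qed.

Section Jacobian.
Variables (u s : R) (y : 'cV[R[i]]_n) (U : 'M[R[i]]_n).
Hypotheses (u_itv : 0 < u < 1) (Fs : F s) (Fy : mx_repr F y) (FU : mx_repr F U).

Definition jacobian_defect :=
  bsub ia u (bpt 1%:M) (bmul ia u (bpt U) (box_jacobian ia u cdf (bball y s))).

Lemma jacobian_defect_repr : box_repr F jacobian_defect.
Proof.
have Fb := bball_repr Fy Fs.
apply: bsub_repr => //; first by apply: bpt_repr; exact: mx_repr1.
by apply: bmul_repr => //; [exact: bpt_repr | exact: box_jacobian_repr].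
Qed.

Lemma jacobian_defect_in w : mxnorm (w - y) <= s ->
  bset jacobian_defect (1%:M - U *m jacobian f w).
Proof.
move=> wy; have Fb := bball_repr Fy Fs.
apply: bsub_in => //; first exact: bpt_in.
apply: bmul_in => //; [exact: bpt_repr | exact: box_jacobian_repr |exact: bpt_in|].
by apply: (box_jacobian_in ia cdf_repr cdfE) => //; exact: bball_in.
Qed.

Lemma unit_ball_in (v : 'cV[R[i]]_n) : mxnorm v <= 1 -> bset (bball 0 1) v.
Proof. by move=> v1; apply: bball_in; rewrite subr0. Qed.

Lemma unit_ball_repr : box_repr F (bball (0 : 'cV[R[i]]_n) 1).
Proof.
apply: bball_repr; last exact: repr1.
by move=> i j; rewrite mxE; split; exact: repr0.
Qed.

Lemma testM_sound rho : 0 < s -> testM ia u cf cdf y s U rho ->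
  moore_box f rho y s U.
Proof.
move=> s0; rewrite /testM => Krho; split=> // v w v1 w1.
apply: le_trans Krho; apply: le_bnorm => i j; rewrite !mxE.
apply: cadd_in => //; last first.
  have := @bmul_in _ _ ia _ u_itv _ _ _ jacobian_defect (bball 0 1)
    jacobian_defect_repr unit_ball_repr
    (1%:M - U *m jacobian f (y + s%:C *: v)) w _ (unit_ball_in w1) i j.
  rewrite !mxE; apply; apply: jacobian_defect_in.
  rewrite addrC addKr; apply: le_trans (mxnormZ _ _) _.
  by rewrite gtr0_norm // ger_pMr.
have := box_residual_in u_itv Fy FU i j; rewrite !mxE => -[h1 h2].
rewrite -(rmorphN (real_complex R)).
by split; rewrite ?cReZ ?cImZ; exact: in_iscale.
Qed.

End Jacobian.

Section Completeness.
Variables (r : R) (x : 'cV[R[i]]_n) (A : 'M[R[i]]_n).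
Hypothesis box : moore_box f (7 / 8) x r A.

Let rho_lt1 : 7 / 8 < 1 :> R. Proof. lra. Qed.

(** [moore_box_residual] is applied to each column, so the factor 8 does not grow with n. For w = I
    it bounds df(y)^-1 by 8 |A|. *)
Lemma inverse_residual y p (w : 'M[R[i]]_(n, p)) : mxnorm (y - x) <= r ->
  mxnorm (invmx (jacobian f y) *m w) <= 8 * mxnorm (A *m w).
Proof.
move=> yx; have [_ Ju] := moore_box_unitmx rho_lt1 box yx.
apply/mxnormP; split=> [|i j]; first by rewrite mulr_ge0 ?mxnorm_ge0.
have := moore_box_residual box (col j (invmx (jacobian f y) *m w)) yx.
have -> : A *m jacobian f y *m col j (invmx (jacobian f y) *m w) = col j (A *m w).
  by rewrite !colE -!mulmxA mulKVmx.
move=> res.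
have le8 : mxnorm (col j (invmx (jacobian f y) *m w)) <= 8 * mxnorm (A *m w).
  have : mxnorm (col j (A *m w)) <= mxnorm (A *m w).
    apply/mxnormP; split=> [|k l]; first exact: mxnorm_ge0.
    by rewrite mxE le_mxnorm_Re le_mxnorm_Im.
  by move: res; lra.
have := le_mxnorm_Re (col j (invmx (jacobian f y) *m w)) i 0.
have := le_mxnorm_Im (col j (invmx (jacobian f y) *m w)) i 0.
by rewrite !mxE => h1 h2; split; apply: le_trans le8.
Qed.

(* The test bounds |s^-1 U f(y)| + |I - U df(y + sB)|; with U close to df(y)^-1
   the second term is O(eta), and the first one is at most 8 |A f(y)| / s up to
   O(eta), because |df(y)^-1 w| <= 8 |A w|. *)
Lemma testM_complete : exists2 c, 1 <= c & forall (tau eta u s : R) y U,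
  0 < tau < 1 -> 0 < eta <= 1 -> 0 < u < 1 -> 0 < s <= eta -> F s ->
  mx_repr F y -> mx_repr F U -> mxnorm (y - x) <= r -> u <= eta * s ->
  mxnorm (U - invmx (jacobian f y)) <= eta ->
  mxnorm (A *m polymap f y) <= tau * s / 32 ->
  bnorm (badd ia u
    (bscale (- s^-1) (bmul ia u (bpt U) (box_map ia u cf (bpt y))))
    (bmul ia u (jacobian_defect u s y U) (bball 0 1))) <= tau / 4 + c * eta.
Proof.
pose M0 := mxnorm x + r + 2.
have r0 : 0 < r by case: box.
have M01 : 1 <= M0 by rewrite /M0; have := mxnorm_ge0 x; lra.
have [Mf M0f f_tame] := box_map_tame ia cf_repr M01.
have [MJ M0J J_tame] := box_jacobian_tame ia cdf_repr M01.
(* The last summand bounds U: df(y)^-1 has norm at most 8 |A|, and U differs from it by at most eta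
   <= 1. *)
pose M := Mf + MJ + (8 * mxnorm A + 1).
have A0 := mxnorm_ge0 A.
have [M1 MfM MJM MA] : [/\ 1 <= M, Mf <= M, MJ <= M & 8 * mxnorm A + 1 <= M].
  by rewrite /M; split; lra.
pose c1 := 4 ^+ n * (24 * M ^+ 2).
(* Two applications of [mxnormM]: one to f(y) = A^-1 (A f(y)), one to (U - df(y)^-1) f(y). *)
pose c2 := 2 * n%:R * (2 * n%:R * mxnorm (invmx A)).
(* Size of I - U df(y) at the center, plus the width of its enclosure over y + sB, both divided by
   eta. *)
pose c3 := 2 * n%:R * M + 4 * c1.
pose c4 := 4 ^+ n * (8 * c3 ^+ 2).
have c11 : 1 <= c1.
  rewrite /c1 mulr_ege1 ?exprn_ege1 ?ler1n //.
  by have := exprn_ege1 2 M1; lra.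
have c20 : 0 <= c2 by rewrite /c2 !mulr_ge0 ?mxnorm_ge0.
have nM : 0 <= 2 * n%:R * M by rewrite !mulr_ge0 //; lra.
have c31 : 1 <= c3 by rewrite /c3; lra.
have c41 : 1 <= c4.
  rewrite /c4 mulr_ege1 ?exprn_ege1 ?ler1n //.
  by have := exprn_ege1 2 c31; lra.
exists (c1 + c2 + c4 + (1 + c1 + c2 + c4)); first by lra.
move=> tau eta u s y U /andP[tau0 tau1] /andP[eta0 eta1] u_itv /andP[s0 s_eta].
move=> Fs Fy FU yx u_etas UJ Afy.
have /andP[u0 u1] := u_itv.
have u_eta : u <= eta by apply: le_trans u_etas _; rewrite ger_pMr //; lra.
have yM : mxnorm y <= mxnorm x + r.
  have := mxnormD (y - x) x; rewrite subrK; lra.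
have [Au Ju] := moore_box_unitmx rho_lt1 box yx.
have UM : mxnorm U <= M.
  have := inverse_residual (1%:M : 'M_n) yx; rewrite !mulmx1 => JA.
  have := mxnormD (U - invmx (jacobian f y)) (invmx (jacobian f y)).
  by rewrite subrK; lra.
have Uf_le : mxnorm (U *m polymap f y) <= s * (tau / 4 + eta * c2).
  have -> : U *m polymap f y = invmx (jacobian f y) *m polymap f y +
      (U - invmx (jacobian f y)) *m polymap f y by rewrite mulmxBl addrC subrK.
  apply: le_trans (mxnormD _ _) _.
  have -> : s * (tau / 4 + eta * c2) = tau * s / 4 + s * eta * c2 by ring.
  apply: lerD; first by have := inverse_residual (polymap f y) yx; lra.
  have f_le : mxnorm (polymap f y) <= 2 * n%:R * mxnorm (invmx A) * s.
    rewrite -{1}(mulKmx Au (polymap f y)).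
    apply: le_trans (mxnormM _ _) _; apply: ler_wpM2l.
      by rewrite !mulr_ge0 ?mxnorm_ge0.
    apply: le_trans Afy _; rewrite -mulrA mulrC -mulrA ger_pMr //; lra.
  apply: le_trans (mxnormM _ _) _.
  have -> : s * eta * c2 = 2 * n%:R * eta * (2 * n%:R * mxnorm (invmx A) * s).
    by rewrite /c2; ring.
  apply: ler_pM => //; rewrite ?mulr_ge0 ?mxnorm_ge0 //.
  by apply: ler_wpM2l => //; rewrite mulr_ge0.
(* The scale is [u], not [eta]: this box is divided by s, and u <= eta s then leaves a width
   O(eta). *)
have res_tame : btame c1 u (bmul ia u (bpt U) (box_map ia u cf (bpt y))).
  apply: bmul_tame => //; [exact: bpt_repr | | |].
  - by apply: box_map_repr => //; exact: bpt_repr.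
  - by apply: bpt_tame => //; exact: ltW.
  - apply: btameW MfM _; first exact: ltW.
    apply: f_tame => //; first exact: bpt_repr.
    by apply: bpt_tame; rewrite ?(ltW u0) // /M0; lra.
have scaled_mag : bmag_le (tau / 4 + eta * (c1 + c2))
    (bscale (- s^-1) (bmul ia u (bpt U) (box_map ia u cf (bpt y)))).
  move=> i j; rewrite mxE.
  have [m1 m2] := cmag_le_in (box_residual_in u_itv Fy FU i j)
    (le_trans (le_mxnorm_Re _ i j) Uf_le) (le_trans (le_mxnorm_Im _ i j) Uf_le)
    (res_tame i j).
  have le_s : `|- s^-1| * (s * (tau / 4 + eta * c2) + c1 * u) <=
      tau / 4 + eta * (c1 + c2).
    rewrite normrN gtr0_norm ?invr_gt0 // ler_pdivrMl //.
    have : c1 * u <= c1 * (eta * s) by apply: ler_wpM2l => //; lra.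
    lra.
  by split; apply: imag_leW le_s _; exact: imag_iscale.
have Fb := bball_repr Fy Fs.
(* The input box now has radius s, so the scale cannot be below s; [eta] is enough. *)
have J_t : btame M eta (box_jacobian ia u cdf (bball y s)).
  apply: btameW MJM _; first exact: ltW.
  apply: J_tame => //; apply: (@btameW _ _ _ (mxnorm x + r + 2)) => //.
    exact: ltW.
  by apply: bball_tame => //; exact: ltW.
have defect_tame : btame (4 * c1) eta (jacobian_defect u s y U).
  apply: bsub_tame => //.
    by apply: bpt_tame; [exact: ltW | exact: le_trans mxnorm1 c11].
  apply: bmul_tame => //; [exact: bpt_repr | exact: box_jacobian_repr |].
  by apply: bpt_tame => //; exact: ltW.
have y_in : mxnorm (y - y) <= s by rewrite subrr mxnorm0 ltW.
have J_le : mxnorm (jacobian f y) <= M.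
  apply: (bmag_le_mxnorm (X := box_jacobian ia u cdf (bball y s))); first by lra.
    by move=> i j; have [[? _] [? _]] := J_t i j.
  by apply: (box_jacobian_in ia cdf_repr cdfE) => //; exact: bball_in.
have defect_le : mxnorm (1%:M - U *m jacobian f y) <= 2 * n%:R * M * eta.
  have -> : 1%:M - U *m jacobian f y =
      (invmx (jacobian f y) - U) *m jacobian f y by rewrite mulmxBl mulVmx.
  apply: le_trans (mxnormM _ _) _; rewrite mxnorm_distC.
  have -> : 2 * n%:R * M * eta = 2 * n%:R * eta * M by ring.
  apply: ler_pM => //; rewrite ?mulr_ge0 ?mxnorm_ge0 //.
  by apply: ler_wpM2l => //; rewrite mulr_ge0.
have defect_mag : bmag_le (c3 * eta) (jacobian_defect u s y U).
  move=> i j; rewrite /c3 mulrDl.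
  apply: cmag_le_in (jacobian_defect_in u_itv Fs Fy FU y_in i j) _ _ _ => //.
    exact: le_trans (le_mxnorm_Re _ i j) defect_le.
  exact: le_trans (le_mxnorm_Im _ i j) defect_le.
have ball_mag : bmag_le 1 (bball (0 : 'cV[R[i]]_n) 1).
  by move=> i j; rewrite !mxE /=; split; split;
    rewrite /= ?sub0r ?add0r ?(min_idPl _) ?(max_idPr _) //; lra.
have prod_mag : bmag_le (c4 * eta) (bmul ia u (jacobian_defect u s y U) (bball 0 1)).
  apply: bmul_mag => //; rewrite ?u_eta //.
    exact: jacobian_defect_repr.
  exact: unit_ball_repr.
apply: bnorm_le => B KB.
have bound0 : 0 <= tau / 4 + (c1 + c2 + c4 + (1 + c1 + c2 + c4)) * eta.
  by rewrite addr_ge0 ?mulr_ge0 //; lra.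
apply: bmag_le_mxnorm KB => // i j; rewrite mxE.
have [S1 S2] := scaled_mag i j; have [P1 P2] := prod_mag i j.
(* A common magnitude bound, at least 1, for the two summands of the last addition, whose roundoff
   is then at most [N * u]. *)
pose N := 1 + c1 + c2 + c4.
have N1 : 1 <= N by rewrite /N; lra.
have e1 : eta * (c1 + c2) <= c1 + c2 by rewrite ler_piMl //; lra.
have e2 : c4 * eta <= c4 by rewrite ler_piMr //; lra.
have aN : tau / 4 + eta * (c1 + c2) <= N by rewrite /N; lra.
have bN : c4 * eta <= N by rewrite /N; lra.
have Nu : N * u <= N * eta by apply: ler_wpM2l => //; lra.
have total : tau / 4 + eta * (c1 + c2) + c4 * eta + N * u <=
    tau / 4 + (c1 + c2 + c4 + (1 + c1 + c2 + c4)) * eta.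
  by move: Nu; rewrite /N; lra.
by split; apply: imag_leW total _; exact: iadd_mag.
Qed.

End Completeness.
End MooreTest.

(** * The algorithm *)

Section Loops.
Variables (S : Type) (cond : S -> bool) (body : S -> S).

(** Any exit index [k] suffices: the loop stops at the first one, which is the [j] found by the
    induction. *)
Lemma while_iter k s : ~~ cond (iter k body s) ->
  exists j, while cond body s (iter j body s) /\ ~~ cond (iter j body s).
Proof.
elim: k s => [|k IH] s /= end_s; first by exists 0%N; split=> //; exact: while_stop.
have [cs|ncs] := boolP (cond s); last by exists 0%N; split=> //; exact: while_stop.
have [j []] := IH (body s) ltac:(by rewrite -iterSr).
by rewrite -iterSr => ? ?; exists j.+1; split=> //; exact: while_loop.
Qed.

Lemma while_invariant (I : S -> Prop) s t : while cond body s t ->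
  (forall s', cond s' -> I s' -> I (body s')) -> I s -> I t.
Proof. by move=> + step; elim=> // s' t' cs _ IH Is; apply: IH; exact: step. Qed.

End Loops.

(** If [P] held infinitely often, [a] would get below every q^m a(0), hence below [c]. It is used
    with the radius at halvings and with |y - z| at quasi-Newton steps. *)
Lemma finitely_often (R : realType) (a : nat -> R) (P : nat -> Prop) (q c : R) :
  0 <= q < 1 -> 0 < c -> (forall k, a k.+1 <= a k) ->
  (forall k, P k -> a k.+1 <= q * a k) -> (forall k, P k -> c <= a k) ->
  exists k0, forall k, (k0 <= k)%N -> ~ P k.
Proof.
move=> /andP[q0 q1] c0 a_mono a_q a_c; apply: contrapT => /forallNP often.
have next k : exists2 l, (k <= l)%N & P l.
  have /existsNP[l /not_implyP[kl /contrapT Pl]] := often k; by exists l.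
have mono k l : (k <= l)%N -> a l <= a k.
  move=> /subnKC <-; elim: (l - k)%N => [|j IH]; rewrite ?addn0 //.
  by rewrite addnS (le_trans (a_mono _)).
have decay m : exists k, a k <= q ^+ m * a 0.
  elim: m => [|m [k ak]]; first by exists 0; rewrite expr0 mul1r.
  have [l kl Pl] := next k; exists l.+1; apply: le_trans (a_q _ Pl) _.
  by rewrite exprS -mulrA ler_wpM2l // (le_trans (mono _ _ kl)).
have /cvgrPdist_lt/(_ _ c0)[m _ /(_ m (leqnn _))] :
    (fun m => q ^+ m * a 0) @ \oo --> (0 * a 0 : R).
  by apply: cvgMl; apply: cvg_expr; rewrite ger0_norm.
rewrite mul0r sub0r normrN => small_m.
have [k ak] := decay m; have [l kl Pl] := next k.
have := a_c _ Pl; have := mono _ _ kl; have := ler_norm (q ^+ m * a 0).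
lra.
Qed.

Section RefineCorrectness.
Variables (R : realType) (F : representable R) (ia : interval_arith F).
Variables (prec : precision_control R) (n : nat) (md : midpoint F n).
Variables (f : 'I_n -> mpoly n R[i]) (ui : unchecked_inverse F f).
Variables (cf : circuit_map R n 'I_n) (cdf : circuit_map R n ('I_n * 'I_n)%type).
Hypotheses (cf_repr : consts_in (crepr F) (cm_circuit cf))
  (cdf_repr : consts_in (crepr F) (cm_circuit cdf)).
Hypotheses (cfE : forall x i, cm_eval cf x i = polymap f x i 0)
  (cdfE : forall x i j, cm_eval cdf x (i, j) = jacobian f x i j).
Variables (x : 'cV[R[i]]_n) (r : R) (A : 'M[R[i]]_n) (tau : R).
Hypotheses (A_repr : mx_repr F A) (tau_itv : 0 < tau < 1).
Hypothesis box : moore_box f (7 / 8) x r A.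
Variable z : 'cV[R[i]]_n.
Hypotheses (fz0 : polymap f z = 0) (zx : mxnorm (z - x) <= 7 / 8 * r).

Let rho_lt1 : 7 / 8 < 1 :> R. Proof. lra. Qed.
Let r_gt0 : 0 < r. Proof. by case: box. Qed.
Let zx_r : mxnorm (z - x) <= r.
Proof. by apply: le_trans zx _; rewrite ger_pMl // ltW. Qed.
Let z_fixed : quasi_newton f A z = z.
Proof. exact/(quasi_newton_fixedP rho_lt1 box zx_r). Qed.

Local Notation residual y := (A *m polymap f y).

Lemma quasi_newton_near_zero y : mxnorm (y - x) <= r ->
  mxnorm (quasi_newton f A y - z) <= 7 / 8 * mxnorm (y - z).
Proof. by move=> yx; rewrite -{1}z_fixed; exact: quasi_newton_lipschitz zx_r. Qed.

(** Triangle inequality through N(y): |y - z| <= |A f(y)| + 7/8 |y - z|. *)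
Lemma dist_zero_le_residual y : mxnorm (y - x) <= r ->
  mxnorm (y - z) <= 8 * mxnorm (residual y).
Proof.
move=> yx; have := quasi_newton_near_zero yx.
have := mxnorm_distD (quasi_newton f A y) y z.
by rewrite {1}/quasi_newton subKr; lra.
Qed.

Lemma residual_le w y :
  mxnorm (residual y) <= mxnorm (y - w) + mxnorm (quasi_newton f A y - w).
Proof.
rewrite (mxnorm_distC (quasi_newton f A y)).
have -> : residual y = y - quasi_newton f A y by rewrite /quasi_newton subKr.
exact: mxnorm_distD.
Qed.

Definition newton_delta (st : state R n) : 'cV[cbox R]_n :=
  bmul ia (st_prec st) (bpt A) (box_map ia (st_prec st) cf (bpt (st_y st))).

Definition newton_box (st : state R n) : 'cV[cbox R]_n :=
  bsub ia (st_prec st) (bpt (st_y st)) (newton_delta st).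

Definition halves (st : state R n) : bool :=
  bnorm (newton_delta st) <= 64^-1 * tau * st_s st.

Definition stalls (st : state R n) : bool :=
  40^-1 * bnorm (newton_delta st) < width (newton_box st).

Local Notation body := (refine_body ia prec md ui cf r A tau).

Definition halved_prec (st : state R n) : R :=
  if 2^-1 * st_s st < 16^-1 * tau * r
  then lower_prec prec (st_prec st) (2^-1 * st_s st) else st_prec st.

Lemma refine_body_halves st : halves st ->
  body st = State (st_y st) (2^-1 * st_s st)
                  (ui (halved_prec st) (st_y st)) (halved_prec st).
Proof. by case: st => y s U u; rewrite /halves /refine_body /= => ->. Qed.

Lemma refine_body_stalls st : ~~ halves st -> stalls st ->
  body st = State (st_y st) (st_s st)
    (ui (incr_prec prec (st_prec st)) (st_y st)) (incr_prec prec (st_prec st)).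
Proof.
case: st => y s U u.
by rewrite /halves /stalls /refine_body /= => /negPf -> ->.
Qed.

Lemma refine_body_newton st : ~~ halves st -> ~~ stalls st ->
  body st = State (md (newton_box st)) (st_s st)
    (ui (st_prec st) (md (newton_box st))) (st_prec st).
Proof.
case: st => y s U u.
by rewrite /halves /stalls /refine_body /= => /negPf -> /negPf ->.
Qed.

(** [inv_ball] gives access to the contraction estimates on x + rB, and [inv_zero] makes [z] the
    zero of the returned box; representability is what the interval products require. *)
Record refine_inv (st : state R n) : Prop := RefineInv {
  inv_ball : mxnorm (st_y st - x) <= r;
  inv_zero : mxnorm (st_y st - z) <= st_s st;
  inv_s_gt0 : 0 < st_s st;
  inv_s_repr : F (st_s st);
  inv_y_repr : mx_repr F (st_y st);
  inv_U_repr : mx_repr F (st_U st);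
  inv_prec : 0 < st_prec st < 1 }.

Section Step.
Variable st : state R n.
Hypothesis inv : refine_inv st.

Lemma newton_delta_in : bset (newton_delta st) (residual (st_y st)).
Proof. by case: inv => *; exact: box_residual_in. Qed.

Lemma newton_delta_repr : box_repr F (newton_delta st).
Proof. by case: inv => *; exact: box_residual_repr. Qed.

Lemma newton_box_in w : bset (newton_delta st) w ->
  bset (newton_box st) (st_y st - w).
Proof. by case: inv => *; apply: bsub_in => //; exact: bpt_in. Qed.

Lemma newton_box_repr : box_repr F (newton_box st).
Proof.
case: inv => *; apply: bsub_repr => //; first exact: bpt_repr.
exact: newton_delta_repr.
Qed.

Lemma residual_le_bnorm : mxnorm (residual (st_y st)) <= bnorm (newton_delta st).
Proof. exact: le_bnorm newton_delta_in. Qed.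

(** The box of y - delta contains y - w for every w in delta, and also N(y); hence w is within the
    width of A f(y). *)
Lemma bnorm_delta_le : bnorm (newton_delta st) <=
  mxnorm (residual (st_y st)) + width (newton_box st).
Proof.
apply: bnorm_le => w dw.
have := le_width (newton_box_in newton_delta_in) (newton_box_in dw).
have -> : st_y st - residual (st_y st) - (st_y st - w) = w - residual (st_y st).
  by apply/colP=> i; rewrite !mxE; ring.
have := mxnormD (w - residual (st_y st)) (residual (st_y st)).
by rewrite subrK; lra.
Qed.

(* The midpoint misses N(y) by at most |delta|/40 <= |A f(y)|/39, and
   7/8 + (15/8)/39 = 12/13. *)
Lemma newton_step : ~~ stalls st ->
  [/\ mxnorm (md (newton_box st) - x) <= r,
      mxnorm (md (newton_box st) - z) <= 12 / 13 * mxnorm (st_y st - z) &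
      bnorm (newton_delta st) <= 2 * mxnorm (residual (st_y st))].
Proof.
rewrite /stalls -leNgt => w_le; case: inv => yx _ _ _ _ _ _.
have := le_width (mid_in md newton_box_repr) (newton_box_in newton_delta_in).
rewrite -/(quasi_newton f A (st_y st)) => e_le.
have bn := bnorm_delta_le.
have near_z := quasi_newton_near_zero yx.
have near_x := quasi_newton_maps box yx.
have res_z : mxnorm (residual (st_y st)) <= 15 / 8 * mxnorm (st_y st - z).
  by have := residual_le z (st_y st); lra.
have res_r : mxnorm (residual (st_y st)) <= 15 / 8 * r.
  by have := residual_le x (st_y st); lra.
have to_z := mxnorm_distD (quasi_newton f A (st_y st)) (md (newton_box st)) z.
have to_x := mxnorm_distD (quasi_newton f A (st_y st)) (md (newton_box st)) x.
have := r_gt0; have := mxnorm_ge0 (residual (st_y st)).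
by split; lra.
Qed.

Lemma halved_prec_itv : 0 < halved_prec st < 1.
Proof.
case: inv => _ _ s0 _ _ _ u_itv; rewrite /halved_prec; case: ifP => // _.
have s2 : 0 < 2^-1 * st_s st by rewrite mulr_gt0 // invr_gt0.
have /andP[-> /le_lt_trans -> //] := lower_prec_le prec u_itv s2.
by case/andP: u_itv.
Qed.

Lemma refine_body_inv : refine_inv (body st).
Proof.
have [yx yz s0 Fs Fy FU u_itv] := inv.
have [t0 t1] := andP tau_itv.
have [hv|nhv] := boolP (halves st).
  rewrite refine_body_halves //; split=> //=.
  - have := dist_zero_le_residual yx; have := residual_le_bnorm.
    have : tau * st_s st <= st_s st by rewrite ler_piMl // ltW.
    by move: hv; rewrite /halves; lra.
  - by rewrite mulr_gt0 // invr_gt0.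
  - by apply: reprM => //; exact: repr_half.
  - by apply: uinv_repr => //; exact: halved_prec_itv.
  - exact: halved_prec_itv.
have [sv|nsv] := boolP (stalls st).
  have i_itv : 0 < incr_prec prec (st_prec st) < 1.
    have /andP[-> /le_lt_trans -> //] := incr_prec_le prec u_itv.
    by case/andP: u_itv.
  by rewrite refine_body_stalls //; split=> //=; exact: uinv_repr.
have [mx mz _] := newton_step nsv.
have Fm : mx_repr F (md (newton_box st)) by apply: mid_repr; exact: newton_box_repr.
rewrite refine_body_newton //; split=> //=; last exact: uinv_repr.
by have := mxnorm_ge0 (st_y st - z); lra.
Qed.

End Step.

Lemma halving_stops : exists2 d, 0 < d & forall st, refine_inv st -> halves st ->
  st_s (body st) < d -> ~~ main_cond ia cf cdf tau (body st).
Proof.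
have [t0 t1] := andP tau_itv.
have [c c1 complete] := testM_complete ia cf_repr cdf_repr cfE cdfE box.
(* Chosen so that tau/4 + c eta = 3/4 tau is at most tau. *)
pose eta := tau / (2 * c).
have eta0 : 0 < eta by rewrite divr_gt0 //; lra.
have c_eta : c * eta = tau / 2 by rewrite /eta; field; lra.
have eta1 : eta <= 1.
  by have : eta <= c * eta by [rewrite ler_peMl // ltW]; lra.
have [d1 d10 omega_s] := omega_le prec eta0.
have unit_y y : mxnorm (y - x) <= r -> jacobian f y \in unitmx.
  by move=> /(moore_box_unitmx rho_lt1 box)[].
have [d2 d20 close] := uinv_close ui eta0 unit_y.
(* The four bounds on the new radius ensure in turn s' <= eta, that the halving lowers the
   precision, omega(s') <= eta s', and a precision at which [uinv] is accurate up to eta. *)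
pose d := Num.min (Num.min eta (16^-1 * tau * r)) (Num.min d1 d2).
exists d; first by rewrite !lt_min eta0 d10 d20 !mulr_gt0 // invr_gt0.
move=> st inv hv; have inv' := refine_body_inv inv.
have u'_itv := halved_prec_itv inv.
have [yx _ s0 _ Fy _ u_itv] := inv.
have [_ _ s'0 Fs' _ FU' _] := inv'.
move: s'0 Fs' FU'; rewrite refine_body_halves //=; set s' := 2^-1 * st_s st.
set u' := halved_prec st => s'0 Fs' FU'.
rewrite !lt_min -!andbA => /and4P[s'_eta s'_r s'_d1 s'_d2].
have u'_omega : u' <= eta * s'.
  apply: le_trans (omega_s s' _); last by rewrite s'0.
  by rewrite /u' /halved_prec -/s' s'_r lower_prec_omega.
have [u'0 u'1] := andP u'_itv.
have u'_d2 : 0 < u' < d2.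
  rewrite u'0 (le_lt_trans u'_omega) // (le_lt_trans _ s'_d2) //.
  by rewrite ler_piMl // ltW.
have res_le : mxnorm (residual (st_y st)) <= tau * s' / 32.
  by have := residual_le_bnorm inv; move: hv; rewrite /halves /s'; lra.
rewrite /main_cond /= negbK /testM.
have := complete tau eta u' s' (st_y st) (ui u' (st_y st)) tau_itv _ u'_itv _ Fs' Fy
  FU' yx u'_omega (close _ _ u'_d2 yx Fy) res_le.
rewrite eta0 eta1 s'0 (ltW s'_eta) => /(_ isT isT) /le_trans; apply.
by rewrite c_eta; lra.
Qed.

(** The constant depends on [y], which is enough because it is applied once [y] has become
    stationary. Point boxes are tame at scale u. *)
Lemma newton_box_width y : mx_repr F y -> exists2 c, 0 < c & forall st,
  0 < st_prec st < 1 -> st_y st = y -> width (newton_box st) <= c * st_prec st.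
Proof.
move=> Fy; have y0 := mxnorm_ge0 y; have A0 := mxnorm_ge0 A.
have y1 : 1 <= 1 + mxnorm y by rewrite lerDl.
have [M yM tame] := box_map_tame ia cf_repr y1.
pose N := M + mxnorm A.
pose c := 4 ^+ n * (24 * N ^+ 2).
have N1 : 1 <= N by rewrite /N; lra.
have N2 : N <= N ^+ 2 by rewrite ler_eXnr.
have Nc : N <= c.
  have p4 : (1 : R) <= 4 ^+ n by rewrite exprn_ege1 ?ler1n.
  apply: le_trans (_ : 24 * N ^+ 2 <= _); first by lra.
  by rewrite /c ler_peMl //; lra.
exists (4 * c); first by lra.
move=> st u_itv yE; have [u0 u1] := andP u_itv.
apply: width_le; first by rewrite mulr_ge0 ?(ltW u0) //; lra.
apply: bsub_tame => //; first by lra.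
  by rewrite yE; apply: bpt_tame; rewrite ?(ltW u0) //; move: Nc; rewrite /N; lra.
apply: bmul_tame => //; [exact: bpt_repr | | |].
- by apply: box_map_repr => //; rewrite yE; exact: bpt_repr.
- by apply: bpt_tame; rewrite ?(ltW u0) // /N; lra.
- apply: (@btameW _ _ _ M); [exact: ltW | by rewrite /N; lra |].
  apply: tame => //; rewrite yE; first exact: bpt_repr.
  by apply: bpt_tame; rewrite ?(ltW u0) //; lra.
Qed.

(** * Termination of the main loop *)

Section Termination.
Variable st0 : state R n.
Hypothesis inv0 : refine_inv st0.
Hypothesis running : forall k, main_cond ia cf cdf tau (iter k body st0).

Let st k := iter k body st0.

Let inv k : refine_inv (st k).
Proof. by elim: k => // k; exact: refine_body_inv. Qed.

Let radius_mono k : st_s (st k.+1) <= st_s (st k).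
Proof.
have s0 := inv_s_gt0 (inv k); rewrite /st iterS -/(st k).
have [hv|nhv] := boolP (halves (st k)).
  by rewrite refine_body_halves //=; lra.
have [sv|nsv] := boolP (stalls (st k)).
  by rewrite refine_body_stalls.
by rewrite refine_body_newton.
Qed.

Let finitely_many_halvings : exists k0, forall k, (k0 <= k)%N -> ~ halves (st k).
Proof.
have [d d0 stop] := halving_stops.
apply: (@finitely_often R (fun k => st_s (st k)) _ 2^-1 d) => //.
- by rewrite invr_ge0 ler0n /= invf_lt1 ?ltr1n.
- by move=> k hv; rewrite /st iterS -/(st k) refine_body_halves.
(* A halving that brings the radius below [d] would make the next test succeed, against
   [running]. *)
- move=> k hv; apply: le_trans (radius_mono k); rewrite leNgt; apply/negP.
  by move=> /(stop _ (inv k) hv); rewrite -iterS running.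
Qed.

Lemma refine_not_running : False.
Proof.
have [t0 t1] := andP tau_itv.
have [k0 nhv] := finitely_many_halvings.
pose tail j := st (k0 + j)%N.
have tailS j : tail j.+1 = body (tail j) by rewrite /tail /st addnS iterS.
have tail_inv j : refine_inv (tail j) := inv (k0 + j)%N.
have {}nhv j : ~~ halves (tail j) by apply/negP/nhv/leq_addr.
have radius j : st_s (tail j) = st_s (tail 0).
  elim: j => // j <-; rewrite tailS; have [sv|nsv] := boolP (stalls (tail j)).
    by rewrite refine_body_stalls.
  by rewrite refine_body_newton.
pose b := 64^-1 * tau * st_s (tail 0).
have b0 : 0 < b.
  by have s0 := inv_s_gt0 (tail_inv 0); rewrite /b !mulr_gt0 // invr_gt0.
have delta_gt j : b < bnorm (newton_delta (tail j)).
  by have := nhv j; rewrite /halves -ltNge radius.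
(* At a quasi-Newton step b < |delta| <= 2 |A f(y)| <= 2 (15/8) |y - z|, so |y - z| >= b/4. *)
have [j0 stall] : exists j0, forall j, (j0 <= j)%N -> ~ ~~ stalls (tail j).
  apply: (@finitely_often R (fun j => mxnorm (st_y (tail j) - z)) _
    (12 / 13) (b / 4)).
  - by apply/andP; split; lra.
  - by rewrite divr_gt0.
  - move=> j; rewrite tailS; have [sv|nsv] := boolP (stalls (tail j)).
      by rewrite refine_body_stalls.
    have [_ near _] := newton_step (tail_inv j) nsv.
    rewrite refine_body_newton //=.
    by have := mxnorm_ge0 (st_y (tail j) - z); lra.
  - move=> j nsv; rewrite tailS refine_body_newton //=.
    by have [] := newton_step (tail_inv j) nsv.
  - move=> j nsv; have [_ _ le2] := newton_step (tail_inv j) nsv.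
    have := delta_gt j; have := quasi_newton_near_zero (inv_ball (tail_inv j)).
    by have := residual_le z (st_y (tail j)); lra.
pose end_ l := tail (j0 + l)%N.
have end_stalls l : stalls (end_ l).
  by have /negP := stall _ (leq_addr l j0); rewrite negbK.
have endS l : end_ l.+1 = State (st_y (end_ l)) (st_s (end_ l))
    (ui (incr_prec prec (st_prec (end_ l))) (st_y (end_ l)))
    (incr_prec prec (st_prec (end_ l))).
  by rewrite /end_ addnS tailS refine_body_stalls //; exact: end_stalls.
have end_y l : st_y (end_ l) = st_y (end_ 0).
  by elim: l => // l <-; rewrite endS.
have [c c0 width_c] := newton_box_width (inv_y_repr (tail_inv (j0 + 0)%N)).
(* At this precision the width is at most b/40 < |delta|/40, so the precision would not be
   increased. *)
have [l u_small] : exists l, st_prec (end_ l) <= b / (40 * c).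
  apply: (@incr_prec_small _ prec (fun l => st_prec (end_ l))).
  - by rewrite divr_gt0 // mulr_gt0.
  - exact: inv_prec (tail_inv _).
  - by move=> l; rewrite endS.
have := end_stalls l; rewrite /stalls => w_gt.
have := width_c _ (inv_prec (tail_inv (j0 + l)%N)) (end_y l).
have := delta_gt (j0 + l)%N.
have : c * st_prec (end_ l) <= b / 40.
  apply: le_trans (ler_wpM2l (ltW c0) u_small) _.
  by rewrite le_eqVlt; apply/orP; left; apply/eqP; field; lra.
rewrite -/(end_ l) => *; lra.
Qed.

End Termination.

Lemma refine_terminates st0 : refine_inv st0 -> exists st,
  [/\ while (main_cond ia cf cdf tau) body st0 st, refine_inv st &
      testM ia (st_prec st) cf cdf (st_y st) (st_s st) (st_U st) tau].
Proof.
move=> inv0; have [k stop] : exists k, ~~ main_cond ia cf cdf tau (iter k body st0).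
  by apply: contrapT => /forallNP run; apply: (refine_not_running inv0) => k;
    have /negP := run k; rewrite negbK.
have [j [run]] := while_iter stop; rewrite /main_cond negbK => test.
exists (iter j body st0); split=> //; apply: while_invariant run _ inv0.
by move=> s _; exact: refine_body_inv.
Qed.

(** The bound 2s <= 1 stops the loop. Doubling keeps |y - z| <= s, and the loop condition is the
    test at the radius about to be adopted, so the final state passes it too. *)
Lemma doubling_terminates st0 : refine_inv st0 ->
  testM ia (st_prec st0) cf cdf (st_y st0) (st_s st0) (st_U st0) tau ->
  exists st,
  [/\ while (double_cond ia cf cdf tau) (@double_radius R n) st0 st, refine_inv st &
      testM ia (st_prec st) cf cdf (st_y st) (st_s st) (st_U st) tau].
Proof.
move=> inv0 test0.
have radius k : st_s (iter k (@double_radius R n) st0) = 2 ^+ k * st_s st0.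
  by elim: k => [|k /= ->]; rewrite ?expr0 ?mul1r // exprS mulrA.
have s0 := inv_s_gt0 inv0.
have [k stop] :
    exists k, ~~ double_cond ia cf cdf tau (iter k (@double_radius R n) st0).
  (* For k > 1/s one has 2^k s >= k s > 1. *)
  have [k ks] : exists k, (st_s st0)^-1 < k%:R.
    exists (Num.bound (st_s st0)^-1); apply: archi_boundP.
    by rewrite invr_ge0 ltW.
  exists k; rewrite /double_cond radius negb_and -ltNge.
  apply/orP; left; have : k%:R <= 2 ^+ k :> R.
    by rewrite -natrX ler_nat ltnW // ltn_expl.
  move: ks; rewrite -(ltr_pM2r s0) mulVf ?gt_eqF // => ks /(ler_wpM2r (ltW s0)).
  lra.
have [j [run _]] := while_iter stop.
exists (iter j (@double_radius R n) st0).
pose good st := refine_inv st /\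
  testM ia (st_prec st) cf cdf (st_y st) (st_s st) (st_U st) tau.
have [] : good (iter j (@double_radius R n) st0); last by split.
apply: while_invariant run _ _; last by split.
move=> [y s U u] /andP[_ test] [[/= yx yz s_gt0 Fs Fy FU u_itv] _]; split=> //.
split=> //=.
- by lra.
- by rewrite mulr_gt0.
- by rewrite (mulrDl 1 1) mul1r; exact: reprD.
Qed.

End RefineCorrectness.

Theorem theorem4p3 (R : realType) (F : representable R)
    (ia : interval_arith F) (prec : precision_control R)
    (n : nat) (md : midpoint F n)
    (f : 'I_n -> mpoly.mpoly n R[i]) (ui : unchecked_inverse F f)
    (cf : circuit_map R n 'I_n) (cdf : circuit_map R n ('I_n * 'I_n)%type)
    (cf_repr : consts_in (crepr F) (cm_circuit cf))
    (cdf_repr : consts_in (crepr F) (cm_circuit cdf))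
    (cfE : forall x i, cm_eval cf x i = polymap f x i 0)
    (cdfE : forall x i j, cm_eval cdf x (i, j) = jacobian f x i j)
    (x : 'cV[R[i]]_n) (r : R) (A : 'M[R[i]]_n) (tau u0 : R)
    (x_repr : mx_repr F x) (r_repr : F r) (A_repr : mx_repr F A)
    (tau_repr : F tau) (u0_itv : 0 < u0 < 1) (tau_itv : 0 < tau < 1)
    (xrA_box : moore_box f (7 / 8) x r A) :
  exists (y : 'cV[R[i]]_n) (s : R) (U : 'M[R[i]]_n),
    [/\ refine_outputs ia prec md ui cf cdf r A tau x u0 y s U,
        moore_box f tau y s U &
        exists z : 'cV[R[i]]_n,
          associated_zero f x r z /\ associated_zero f y s z].
Proof.
have rho_lt1 : 7 / 8 < 1 :> R by lra.
have r_gt0 : 0 < r by case: xrA_box.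
have [z fz0 zx] := moore_box_zero_exists rho_lt1 xrA_box.
have zx_r : mxnorm (z - x) <= r by apply: le_trans zx _; rewrite ger_pMl // ltW.
have inv0 : refine_inv F x r z (State x r A u0).
  by split=> //=; [rewrite subrr mxnorm0 ltW | rewrite mxnorm_distC].
have [st [run1 inv1 test1]] := refine_terminates ia prec md ui cf_repr cdf_repr
  cfE cdfE A_repr tau_itv xrA_box fz0 zx inv0.
have [[y s U u] [run2 inv2 test2]] :=
  doubling_terminates inv1 test1.
have [_ /= yz s0 Fs Fy FU u_itv] := inv2.
have tau_lt1 : tau < 1 by case/andP: tau_itv.
(* Uniqueness of the zero in the output box follows from this box property and tau < 1; existence is
   the invariant |y - z| <= s. *)
have box' := testM_sound cf_repr cdf_repr cfE cdfE u_itv Fs Fy FU s0 test2.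
exists y, s, U; split=> //; first by exists st, u.
exists z; split; split=> //.
- move=> w [fw0 wx].
  exact: (moore_box_zero_unique rho_lt1 xrA_box zx_r wx fz0 fw0).
- by rewrite mxnorm_distC.
- move=> w [fw0 wy]; rewrite mxnorm_distC in yz.
  exact: (moore_box_zero_unique tau_lt1 box' yz wy fz0 fw0).
Qed.
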